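(* There is an algorithm that, given an $n$-vertex hypergraph $H$ of rank at most $3$, enumerates (outputs) all minimal transversals of $H$ in time $O(1.6755^n)$.
   Context: A hypergraph $H=(V,E)$ consists of a finite vertex set $V$ and a set $E$ of subsets of $V$ called hyperedges; $n=|V|$. The rank of $H$ is the maximum size of a hyperedge. A transversal of $H$ is a set $S\subseteq V$ intersecting every hyperedge of $E$; it is minimal if no proper subset of $S$ is a transversal of $H$. *)

(* Defs.v *)
From mathcomp Require Import all_boot.
Set Implicit Arguments. Unset Strict Implicit. Unset Printing Implicit Defensive.

Definition transversal (n : nat) (E : {set {set 'I_n}}) (S : {set 'I_n}) : bool :=
  [forall e in E, [exists x in e, x \in S]].

Definition minimal_transversal (n : nat) (E : {set {set 'I_n}}) (S : {set 'I_n}) : bool :=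
  transversal E S && [forall S' : {set 'I_n}, (S' \proper S) ==> ~~ transversal E S'].

Definition min_transversals (n : nat) (E : {set {set 'I_n}}) : {set {set 'I_n}} :=
  [set S | minimal_transversal E S].

(* ---------- A unit-cost random access machine (Cook--Reckhow style) ----------
   Registers are indexed by nat and hold nat. Instructions: *)
Inductive instr : Type :=
  | ICONST (r k : nat)
  | IADD (r a b : nat)
  | ISUB (r a b : nat)        (* M[r] := M[a] - M[b] (truncated) *)
  | ILOAD (r a : nat)
  | ISTORE (a r : nat)
  | IJZ (r l : nat)
  | IOUT (r : nat)
  | IHALT.

Record state : Type := St { pc : nat; mem : nat -> nat; out : seq nat }.

Definition upd (M : nat -> nat) (a v : nat) : nat -> nat :=
  fun x => if x == a then v else M x.

(* One step; None means the machine halts (IHALT or pc out of the program). *)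
Definition step (P : seq instr) (s : state) : option state :=
  let M := mem s in
  match nth IHALT P (pc s) with
  | ICONST r k => Some (St (pc s).+1 (upd M r k) (out s))
  | IADD r a b => Some (St (pc s).+1 (upd M r (M a + M b)) (out s))
  | ISUB r a b => Some (St (pc s).+1 (upd M r (M a - M b)) (out s))
  | ILOAD r a => Some (St (pc s).+1 (upd M r (M (M a))) (out s))
  | ISTORE a r => Some (St (pc s).+1 (upd M (M a) (M r)) (out s))
  | IJZ r l => Some (St (if M r == 0 then l else (pc s).+1) M (out s))
  | IOUT r => Some (St (pc s).+1 M (rcons (out s) (M r)))
  | IHALT => None
  end.

(* exec P t s = Some s' iff the machine started in s halts within t steps
   (each executed instruction, including the final halt, costs one step),
   s' being the final state. *)
Fixpoint exec (P : seq instr) (t : nat) (s : state) : option state :=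
  match t with
  | 0 => None
  | t'.+1 => match step P s with
             | None => Some s
             | Some s' => exec P t' s'
             end
  end.

(* Input: a list of hyperedges, each a list of (at most 3) vertices.
   Memory layout: M[0] = n, M[1] = number of edges, and the i-th edge occupies
   cells 2+3i, 2+3i+1, 2+3i+2, holding (vertex + 1) or 0 for an empty slot.
   All other cells are 0. *)
Definition slot (n : nat) (e : seq 'I_n) (j : nat) : nat :=
  if nth None (map Some e) j is Some v then (nat_of_ord v).+1 else 0.

Definition input_mem (n : nat) (Es : seq (seq 'I_n)) : nat -> nat :=
  fun x =>
    if x == 0 then n
    else if x == 1 then size Es
    else if x < 2 + 3 * size Es then slot (nth [::] Es ((x - 2) %/ 3)) ((x - 2) %% 3)
    else 0.

Definition init_state (n : nat) (Es : seq (seq 'I_n)) : state :=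
  St 0 (input_mem Es) [::].

Definition edge_set (n : nat) (Es : seq (seq 'I_n)) : {set {set 'I_n}} :=
  [set S : {set 'I_n} | S \in [seq [set x in e] | e <- Es]].

(* Output: each listed set is written as its vertices (as v+1, in any order,
   without repetition) followed by the separator 0.  The output enumerates the
   family T if it lists every member of T exactly once and nothing else. *)
Definition enumerates (n : nat) (T : {set {set 'I_n}}) (o : seq nat) : Prop :=
  exists L : seq (seq 'I_n),
    [/\ all uniq L,
        uniq [seq [set x in s] | s <- L],
        (forall S : {set 'I_n}, (S \in T) = (S \in [seq [set x in s] | s <- L]))
      & o = flatten [seq rcons [seq (nat_of_ord v).+1 | v <- s] 0 | s <- L]].

(* Main.v *)
(** Monotone local search.  If X is contained in a minimal transversal S, then S is
    reached from X by |S \ X| ternary branchings: take an edge missed by the current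
    set and guess one of its vertices lying in S.  When every vertex is put into X
    with probability 2/5, and every branching is guessed at random, S is reached with
    probability (2/5 + 3/5 * 1/3)^|S| * (3/5)^(n - |S|) = (3/5)^n, whatever S is.

    To derandomize, the vertices are cut into blocks of a constant size b.  A greedy
    cover of the power set of a block by pairs (X, d), where (X, d) covers S if X is
    contained in S and |S \ X| = d, has total cost (the sum of the 3^d) at most
    2 (b + 1)^2 (5/3)^b, which is below 1.67^b for a suitable b.  This cover is
    hard-wired in the program as a table whose rows list X and one string of d
    branching choices.  The program runs through all sequences of rows, one row per
    block: it first takes the union of the sets X, then executes all the branching
    choices, tests whether the result is a minimal transversal, and prints it unless
    it was printed before.  The polynomial factors disappear in the gap between 1.67
    and 1.6755. *)

Require Import Defs.
From mathcomp Require Import all_boot zify.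
Set Implicit Arguments. Unset Strict Implicit. Unset Printing Implicit Defensive.

(** * Numerical bounds *)

(** One fixed list of instructions must serve every [n], so only a table of constant size can be
    hard-wired; this forces the blocks. Edges cross blocks, but this does no harm: a branching
    choice need not repair the block whose row lists it. The choices of all rows form one string,
    and only its total length, the number of vertices of S outside the union of the sets X, matters.
    If the current set becomes a transversal early, minimality of S shows that it already equals S,
    and the remaining choices do nothing.

    The last block may contain padding vertices beyond [n]. They lie in no edge, so the minimality
    test rejects every candidate that contains one.

    The other obstacle is the machine. It has no multiplication or division, and the input fills
    memory from cell 0, with two cells that may be overwritten at the start. Hence the relocation of
    the input, the tabulated quotients, and a loop language whose loop bounds are evaluated on
    entry: termination is automatic, and the cost of the compiled code is a function of the source
    program. *)

Lemma leq_expl (m n e : nat) : m <= n -> m ^ e <= n ^ e.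
Proof. by case: e => // e; rewrite leq_exp2r. Qed.

(** Bernoulli's inequality, free of division: raising the base by one pays for one factor [n.+1]. *)
Lemma mul_expn_leS (A n : nat) : n.+1 * A ^ n <= A.+1 * A.+1 ^ n.
Proof.
have bern : n * A ^ n + A * A ^ n <= A * A.+1 ^ n.
  elim: n => [|n IHn]; first by rewrite !expn0 mul0n.
  rewrite !expnS; have := leq_expl n (leqnSn A); nia.
have := leq_expl n (leqnSn A); nia.
Qed.

(** After scaling both bases by [k.+1] there is room for [k] unit steps between them, and each step
    absorbs one factor [n.+1] by Bernoulli's inequality. *)
Lemma poly_expn_le (A B k : nat) : A < B ->
  exists c, forall n, n.+1 ^ k * A ^ n <= c * B ^ n.
Proof.
move=> ltAB.
have [c Hc] : exists c, forall n, n.+1 ^ k * (A * k.+1) ^ n <= c * (A * k.+1 + k) ^ n.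
  elim: {1 4}k => [|j [c IH]]; first by exists 1 => n; rewrite addn0 expn0.
  exists ((A * k.+1 + j).+1 * c) => n.
  have := mul_expn_leS (A * k.+1 + j) n; have := IH n.
  rewrite expnS addnS; nia.
exists c => n; rewrite -(@leq_pmul2r (k.+1 ^ n)) ?expn_gt0 // -!mulnA -!expnMn.
apply: leq_trans (Hc n) _; rewrite leq_mul2l; apply/orP; right.
by apply: leq_expl; nia.
Qed.

(** The numbers come from 5/3 = 500/300 and 1.67 = 501/300. The growth bound is used with exponent 3
    instead of 2, so that the spare factor [b.+1] absorbs the constants [2] and [c]. *)
Lemma exists_block_size : exists2 b, 0 < b & 2 * b.+1 ^ 2 * 500 ^ b <= 501 ^ b.
Proof.
have [c Hc] := @poly_expn_le 500 501 3 isT.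
have [b le_cb Hb] : exists2 b, 2 * c < b & b.+1 ^ 3 * 500 ^ b <= c * 501 ^ b.
  by exists (2 * c).+1.
have b_gt0 : 0 < b by apply: leq_trans le_cb.
exists b => //; move: (500 ^ b) (501 ^ b) Hb => x y Hb.
rewrite -(leq_pmul2l b_gt0).
apply: (@leq_trans (2 * (b.+1 ^ 3 * x))).
  by rewrite mulnA [2 * (_ * x)]mulnA leq_mul2r; apply/orP; right; rewrite !expnS expn0; nia.
rewrite (leq_trans (leq_mul (leqnn 2) Hb)) // mulnA leq_mul2r.
by apply/orP; right; rewrite ltnW.
Qed.

(** * Greedy covers of a power set *)

(** Expand the product of [F i + G i] over all [i]: a subset X contributes the product of F on X and
    of G off X. Taking F = 0 and G = 1 outside [S] kills the subsets not contained in [S] and leaves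
    the other terms unchanged. *)
Lemma sum_subset_powers (T : finType) (S : {set T}) x y :
  \sum_(X : {set T} | X \subset S) x ^ #|X| * y ^ (#|S| - #|X|) = (x + y) ^ #|S|.
Proof.
pose F i := if i \in S then x else 0; pose G i := if i \in S then y else 1.
have -> : (x + y) ^ #|S| = \prod_(i : T) (F i + G i).
  rewrite (bigID (mem S)) /= [X in _ * X]big1 ?muln1; last first.
    by move=> i /negbTE iS; rewrite /F /G iS.
  by rewrite -prod_nat_const; apply: eq_bigr => i iS; rewrite /F /G iS.
rewrite bigA_distr big_mkcond /=; apply: eq_bigr => X _.
case: ifP => [sXS|/negbT/subsetPn[i iX iS]]; last first.
  by rewrite (bigD1 i) //= iX /F (negbTE iS).
rewrite (bigID (mem X)) /=; congr (_ * _).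
  rewrite -prod_nat_const; apply: eq_bigr => i iX; rewrite iX /F.
  by rewrite (subsetP sXS).
rewrite (bigID (mem S)) /= [X in _ * X]big1 ?muln1; last first.
  by move=> i /andP[/negbTE iX /negbTE iS]; rewrite iX /G iS.
rewrite -(setIidPr sXS) -cardsD -prod_nat_const.
apply: eq_big => [i|i]; first by rewrite !inE; case: (i \in X); case: (i \in S).
by rewrite !inE => /andP[/negbTE-> iS]; rewrite /G iS.
Qed.

Section Cover.
Variable b : nat.
Implicit Types (X S : {set 'I_b}) (R : {set {set 'I_b}}).

Definition covers (q : {set 'I_b} * 'I_b.+1) S := (q.1 \subset S) && (#|S :\: q.1| == q.2 :> nat).

(* Up to the factor 15^b, the probability that X is drawn when every vertex is picked
   with probability 2/5, times 3^(-d). *)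
Definition pair_weight (q : {set 'I_b} * 'I_b.+1) := 2 ^ #|q.1| * 3 ^ (b - #|q.1|) * 3 ^ (b - q.2).

Lemma sum_weight_cost : \sum_q pair_weight q * 3 ^ q.2 = b.+1 * 15 ^ b.
Proof.
rewrite -(pair_bigA _ (fun X (d : 'I_b.+1) => pair_weight (X, d) * 3 ^ d)) /=.
rewrite (eq_bigr (fun X => 2 ^ #|X| * 3 ^ (b - #|X|) * (b.+1 * 3 ^ b))); last first.
  move=> X _; rewrite (eq_bigr (fun=> 2 ^ #|X| * 3 ^ (b - #|X|) * 3 ^ b)).
    by rewrite sum_nat_const card_ord mulnCA.
  by move=> d _; rewrite /pair_weight -!mulnA -expnD subnK // -ltnS.
rewrite -big_distrl /= (_ : 15 = 5 * 3) // expnMn mulnCA; congr (_ * _).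
have := sum_subset_powers [set: 'I_b] 2 3; rewrite cardsT card_ord => <-.
congr (_ * _); apply: eq_bigl => X; by rewrite subsetT.
Qed.

(** Only d = |S| - |X| contributes, and then the powers of 3 combine to 3^(2b - |S|) for every X.
    The binomial sum of 2^|X| gives 3^|S|, so the total does not depend on [S]. This balance is what
    the probability 2/5 is chosen for. *)
Lemma sum_weight_covers S : \sum_(q | covers q S) pair_weight q = 9 ^ b.
Proof.
rewrite -(pair_big_dep xpredT (fun X (d : 'I_b.+1) => covers (X, d) S) (fun X d =>
  pair_weight (X, d))) /=.
have leSb : #|S| <= b by have := max_card S; rewrite card_ord.
have Hd X : #|S :\: X| < b.+1 by rewrite ltnS (leq_trans _ leSb) // subset_leq_card ?subsetDl.
rewrite (eq_bigr (fun X =>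
  if X \subset S then 2 ^ #|X| * 1 ^ (#|S| - #|X|) * (3 ^ b * 3 ^ (b - #|S|)) else 0)).
  rewrite -big_mkcond -big_distrl /= sum_subset_powers mulnCA -expnD subnKC //.
  by rewrite (_ : 9 = 3 * 3) // expnMn.
move=> X _; case: ifP => sXS; last by rewrite big_pred0 // => d; rewrite /covers /= sXS.
rewrite (big_pred1 (Ordinal (Hd X))) /=; last first.
  by move=> d; rewrite /covers /= sXS /= -val_eqE /= eq_sym.
have leX := subset_leq_card sXS.
rewrite /pair_weight /= exp1n muln1 -mulnA -!expnD; congr (_ * 3 ^ _).
by rewrite cardsD (setIidPr sXS); move: #|S| #|X| leX leSb => *; lia.
Qed.

(** Averaging: with the weights [pair_weight], the two sides have the same sum over all pairs, by
    double counting on the left and by the total cost on the right. So they cannot be strictly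
    ordered at every pair. *)
Lemma efficient_pair R : exists q : {set 'I_b} * 'I_b.+1,
  3 ^ b * #|R| * 3 ^ q.2 <= #|[set S in R | covers q S]| * (b.+1 * 5 ^ b).
Proof.
have tot : \sum_q pair_weight q * #|[set S in R | covers q S]| = 9 ^ b * #|R|.
  move: (9 ^ b) sum_weight_covers => N key.
  rewrite (eq_bigr (fun q => \sum_(S in R) if covers q S then pair_weight q else 0)); last first.
    move=> q _; rewrite -big_mkcondr /= mulnC -sum_nat_const.
    by apply: eq_bigl => S; rewrite inE.
  rewrite exchange_big /= mulnC -sum_nat_const; apply: eq_bigr => S _.
  by rewrite -(key S) [RHS]big_mkcond.
apply/existsP; apply: contraT => /existsPn H.
have lt q : pair_weight q * (#|[set S in R | covers q S]| * (b.+1 * 5 ^ b)) <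
    pair_weight q * (3 ^ b * #|R| * 3 ^ q.2).
  have w_gt0 : 0 < pair_weight q by rewrite /pair_weight !muln_gt0 !expn_gt0.
  by rewrite (ltn_pmul2l w_gt0) ltnNge H.
have : \sum_q pair_weight q * (#|[set S in R | covers q S]| * (b.+1 * 5 ^ b)) <
    \sum_q pair_weight q * (3 ^ b * #|R| * 3 ^ q.2).
  (* Strictness of the sum needs at least one pair; any would do. *)
  rewrite (bigD1 (set0, ord0)) // [X in _ < X](bigD1 (set0, ord0)) //=.
  rewrite -addSn; apply: leq_add; [exact: lt | by apply: leq_sum => q _; apply/ltnW/lt].
rewrite (eq_bigr (fun q => pair_weight q * #|[set S in R | covers q S]| * (b.+1 * 5 ^ b)));
  last by move=> q _; rewrite mulnA.
rewrite -big_distrl /= tot (eq_bigr (fun q => pair_weight q * 3 ^ q.2 * (3 ^ b * #|R|)));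
  last by move=> q _; rewrite -[RHS]mulnA [3 ^ q.2 * _]mulnC.
rewrite -big_distrl /= sum_weight_cost (_ : 9 = 3 * 3) // (_ : 15 = 5 * 3) // !expnMn.
move: (3 ^ b) (5 ^ b) #|R| => x y z.
by rewrite [X in X < _](_ : _ = b.+1 * (y * x) * (x * z)) ?ltnn //; lia.
Qed.

Definition cover_cost (Q : seq ({set 'I_b} * 'I_b.+1)) := \sum_(q <- Q) 3 ^ q.2.

(** One phase per halving of [R]. While at least 2^k sets remain, an efficient pair costs at most F
    / (3^b 2^k) per newly covered set; a phase covers fewer than 2^(k+1) sets, so it costs at most 2
    F / 3^b. *)
Lemma greedy_cover k R : #|R| < 2 ^ k ->
  exists2 Q, {in R, forall S, has (covers^~ S) Q} & 3 ^ b * cover_cost Q <= 2 * k * (b.+1 * 5 ^ b).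
Proof.
set F := b.+1 * 5 ^ b; elim: k R => [|k IHk] R ltR.
  exists [::]; last by rewrite /cover_cost big_nil muln0.
  by move=> S SR; move: ltR; rewrite expn0 ltnS leqn0 cards_eq0 => /eqP R0; rewrite R0 inE in SR.
(* Potential argument inside a phase: each chosen pair is paid for by the drop of [F * #|R|], and
   the earlier bound takes over once [R] has fewer than 2^k sets. *)
suff [Q HQ leQ] : exists2 Q, {in R, forall S, has (covers^~ S) Q} &
    2 ^ k * (3 ^ b * cover_cost Q) <= 2 ^ k * (2 * k * F) + F * #|R|.
  exists Q => //; rewrite -(@leq_pmul2l (2 ^ k)) ?expn_gt0 // (leq_trans leQ) //.
  move: ltR; rewrite expnS; move: (2 ^ k) (F) #|R| => *; nia.
move: {2}#|R|.+1 (ltnSn #|R|) => r; elim: r R {ltR} => // r IHr R ltRr.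
have [ltR|geR] := ltnP #|R| (2 ^ k).
  have [Q HQ leQ] := IHk R ltR; exists Q => //.
  by rewrite (leq_trans _ (leq_addr _ _)) // leq_mul2l leQ orbT.
have [q Hq] := efficient_pair R; set C := [set S in R | covers q S] in Hq.
have sCR : C \subset R by apply/subsetP => S; rewrite inE => /andP[].
have cardR' := cardsD R C; rewrite (setIidPr sCR) in cardR'.
have leC := subset_leq_card sCR.
have C_gt0 : 0 < #|C|.
  have R_gt0 : 0 < #|R| by rewrite (leq_trans _ geR) ?expn_gt0.
  suff : 0 < #|C| * F by case: #|C|.
  by rewrite (leq_trans _ Hq) // !muln_gt0 !expn_gt0 R_gt0.
have [|Q HQ leQ] := IHr (R :\: C); first by rewrite cardR';
  move: #|R| #|C| ltRr leC C_gt0 => *; lia.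
exists (q :: Q) => [S SR /=|].
  have [//|nqS] := boolP (covers q S); apply: HQ.
  by rewrite !inE SR (negbTE nqS).
rewrite /cover_cost big_cons -/(cover_cost Q) [X in 2 ^ k * X]mulnDr mulnDr.
move: leQ; rewrite cardR'; have : 2 ^ k * (3 ^ b * 3 ^ q.2) <= #|C| * F.
  by rewrite (leq_trans _ Hq) // mulnA leq_mul2r [X in _ <= X]mulnC leq_mul2r geR !orbT.
have -> : F * #|R| = F * (#|R| - #|C|) + #|C| * F by rewrite mulnC [F * _]mulnC -mulnDl subnK.
by move: (2 ^ k * _) (2 ^ k * _) (F * _) (#|C| * F) => *; lia.
Qed.

Lemma exists_cover : exists2 Q : seq ({set 'I_b} * 'I_b.+1),
  forall S, has (covers^~ S) Q & 3 ^ b * cover_cost Q <= 2 * b.+1 ^ 2 * 5 ^ b.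
Proof.
have [|Q HQ leQ] := @greedy_cover b.+1 setT.
  by rewrite -powersetT card_powerset cardsT card_ord ltn_exp2l.
by exists Q => [S|]; [apply: HQ; rewrite inE | rewrite (leq_trans leQ) // expnS expn1 !mulnA].
Qed.
End Cover.

Definition mem_nat b (X : {set 'I_b}) : pred nat :=
  fun p => if insub p is Some i then i \in X else false.

Definition is_trit t := 0 < t <= 3.

(* The branching choices are the numbers 1, 2, 3; they are padded with 0 (no branching). *)
Definition row b (X : pred nat) (ts : seq nat) : seq nat :=
  [seq X p : nat | p <- iota 0 b] ++ ts ++ nseq (b - size ts) 0.

Definition rows_of b (Q : seq ({set 'I_b} * 'I_b.+1)) :=
  [seq row b (mem_nat q.1) [seq (val i).+1 | i <- t]
    | q : {set 'I_b} * 'I_b.+1 <- Q, t : seq 'I_3 <- [seq tval t | t <- enum {: q.2.-tuple 'I_3}]].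

Lemma size_rows_of b Q : size (@rows_of b Q) = cover_cost Q.
Proof.
rewrite /rows_of size_allpairs_dep /cover_cost sumnE big_map.
by apply: eq_bigr => q _; rewrite size_map -cardE card_tuple card_ord.
Qed.

(** [X] is the choice function of the cover: it sends a trace [s] on a block to the first component
    of the first pair covering it. As every string of the right length is a row, the choices may be
    fixed later, depending on what happened in other blocks. *)
Lemma exists_table : exists (b : nat) (rows : seq (seq nat)) (X : pred nat -> pred nat),
  [/\ 0 < b, 0 < size rows, size rows * 100 ^ b <= 167 ^ b, all (fun r => size r == 2 * b) rows &
    forall s, subpred (X s) s /\
      forall ts, size ts = count (predD s (X s)) (iota 0 b) ->
        all is_trit ts -> row b (X s) ts \in rows].
Proof.
have [b b_gt0 Hb] := exists_block_size; have [Q HQ leQ] := exists_cover b.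
pose cover (s : pred nat) := nth (set0, ord0) Q (seq.find (fun q =>
  covers q [set p : 'I_b | s p]) Q).
exists b, (rows_of Q), (fun s => mem_nat (cover s).1); rewrite size_rows_of; split => //.
- case: Q HQ {leQ cover} => [/(_ set0)//|q Q _]; rewrite /cover_cost big_cons.
  by rewrite (leq_trans _ (leq_addr _ _)) // expn_gt0.
- rewrite -(@leq_pmul2l (3 ^ b)) ?expn_gt0 // mulnA -!expnMn (leq_trans _ Hb) //.
  by rewrite (_ : 500 = 5 * 100) // expnMn [X in _ <= X]mulnA leq_mul2r leQ orbT.
- apply/allP => r /allpairsPdep[q [t [_ /mapP[t' _ ->] ->]]].
  rewrite !size_cat !size_map size_iota size_nseq size_tuple.
  by have := ltn_ord q.2; move: (q.2 : nat) => d; lia.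
move=> s; move: (HQ [set p : 'I_b | s p]).
move=> /[dup] /(nth_find (set0, ord0)); rewrite has_find => + /(mem_nth (set0, ord0)).
rewrite -/(cover s); move: (cover s) => q /andP[/= /subsetP sub /eqP cardq] qQ.
split=> [p|ts size_ts ts3].
  by rewrite /mem_nat; case: insubP => // i _ <- /sub; rewrite inE.
have size_ts' : size ts = q.2.
  rewrite size_ts -cardq -val_enum_ord count_map cardE -size_filter /enum_mem -filter_predI.
  congr (size _); apply: eq_filter => i /=; rewrite !inE.
  by rewrite /mem_nat valK andbT.
apply/allpairsPdep.
have inK : [seq (val i).+1 | i <- [seq (inord t.-1 : 'I_3) | t <- ts]] = ts.
  rewrite -map_comp -[RHS]map_id; apply/eq_in_map => t /(allP ts3) /andP[t0 t3] /=.
  by rewrite inordK prednK.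
have szt : size [seq (inord t.-1 : 'I_3) | t <- ts] == q.2 by rewrite size_map size_ts'.
exists q, (tval (Tuple szt)); split => //; first by apply: map_f; rewrite mem_enum.
by rewrite inK.
Qed.

(** * A loop language *)

Inductive exp :=
  | Const (k : nat) | Reg (r : nat) | Plus (e1 e2 : exp) | Minus (e1 e2 : exp)
  | Get (a : nat) (e : exp) | Inp (e : exp).

Inductive cmd :=
  | Skip
  | Asg (r : nat) (e : exp)
  | Put (a : nat) (i e : exp)
  | Out (e : exp)
  | Seq (c1 c2 : cmd)
  | When (e : exp) (c : cmd)
  | Loop (e : exp) (c : cmd).

Record lst := LS { rg : nat -> nat; hp : nat -> nat -> nat; ou : seq nat }.

Section Sem.
Variable inp : nat -> nat.

Fixpoint eval (s : lst) (e : exp) : nat :=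
  match e with
  | Const k => k
  | Reg r => rg s r
  | Plus e1 e2 => eval s e1 + eval s e2
  | Minus e1 e2 => eval s e1 - eval s e2
  | Get a e => hp s a (eval s e)
  | Inp e => inp (eval s e)
  end.

Definition updh (h : nat -> nat -> nat) a v := fun a' => if a' == a then v else h a'.

Fixpoint sem (c : cmd) (s : lst) : lst :=
  match c with
  | Skip => s
  | Asg r e => LS (upd (rg s) r (eval s e)) (hp s) (ou s)
  | Put a i e => LS (rg s) (updh (hp s) a (upd (hp s a) (eval s i) (eval s e))) (ou s)
  | Out e => LS (rg s) (hp s) (rcons (ou s) (eval s e))
  | Seq c1 c2 => sem c2 (sem c1 s)
  | When e c => if eval s e == 0 then s else sem c s
  | Loop e c => iter (eval s e) (sem c) s
  end.

Fixpoint ecost (e : exp) : nat :=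
  match e with
  | Const _ => 1
  | Reg _ => 2
  | Plus e1 e2 | Minus e1 e2 => ecost e1 + ecost e2 + 1
  | Get _ e => ecost e + 7
  | Inp e => ecost e + 10
  end.

(** The constants are the lengths of the code fragments emitted by the compiler. The result is an
    upper bound on the number of steps: [Inp] is charged for ten instructions, although two of its
    three paths skip some. *)
Fixpoint cost (c : cmd) (s : lst) : nat :=
  match c with
  | Skip => 0
  | Asg _ e => ecost e + 2
  | Put _ i e => ecost i + ecost e + 7
  | Out e => ecost e + 1
  | Seq c1 c2 => cost c1 s + cost c2 (sem c1 s)
  | When e c => ecost e + 1 + (if eval s e == 0 then 0 else cost c s)
  | Loop e c => ecost e + 1 + \sum_(k < eval s e) (cost c (iter k (sem c) s) + 5)
  end.

Section StaticCost.
(* The registers that bound the loops; [static] programs do not change them. *)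
Variable ro : pred nat.

Fixpoint closed_exp e :=
  match e with
  | Const _ => true
  | Reg r => ro r
  | Plus e1 e2 | Minus e1 e2 => closed_exp e1 && closed_exp e2
  | Get _ _ | Inp _ => false
  end.

Fixpoint static c :=
  match c with
  | Skip | Put _ _ _ | Out _ => true
  | Asg r _ => ~~ ro r
  | Seq c1 c2 => static c1 && static c2
  | When _ c => static c
  | Loop e c => closed_exp e && static c
  end.

(** All bounds are evaluated in the one state [s], even those of inner loops. This is sound for
    [static] programs, since the registers in their loop bounds never change. *)
Fixpoint loops_le (B : nat) s c :=
  match c with
  | Skip | Put _ _ _ | Out _ | Asg _ _ => true
  | Seq c1 c2 => loops_le B s c1 && loops_le B s c2
  | When _ c => loops_le B s c
  | Loop e c => (eval s e <= B) && loops_le B s c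
  end.

Fixpoint depth c :=
  match c with
  | Skip | Put _ _ _ | Out _ | Asg _ _ => 0
  | Seq c1 c2 => maxn (depth c1) (depth c2)
  | When _ c => depth c
  | Loop _ c => (depth c).+1
  end.

Fixpoint weight c :=
  match c with
  | Skip => 0
  | Asg _ e => ecost e + 2
  | Put _ i e => ecost i + ecost e + 7
  | Out e => ecost e + 1
  | Seq c1 c2 => weight c1 + weight c2
  | When e c => ecost e + 1 + weight c
  | Loop e c => ecost e + 1 + (weight c + 5)
  end.

Definition agree s s' := forall r, ro r -> rg s' r = rg s r.

Lemma iter_agree f : (forall s, agree s (f s)) -> forall n s, agree s (iter n f s).
Proof. by move=> Hf n s; elim: n => // n IH r ror; rewrite iterS Hf // IH. Qed.

Lemma static_agree c s : static c -> agree s (sem c s).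
Proof.
elim: c s => //= [r e s ror r' ror' /=|c1 IH1 c2 IH2 s /andP[st1 st2] r ror|e c IH s st|e c IH
  s /andP[_ st]].
- by rewrite /upd; case: eqP => // er; rewrite er (negbTE ror) in ror'.
- by rewrite IH2 // IH1.
- by case: eqP => // _; apply: IH.
- by apply: iter_agree => s'; apply: IH.
Qed.

Lemma eval_agree s s' e : agree s s' -> closed_exp e -> eval s' e = eval s e.
Proof.
move=> ss'; elim: e => [k|r|e1 IH1 e2 IH2|e1 IH1 e2 IH2|//|//] //=; first exact: ss'.
  by move=> /andP[/IH1-> /IH2->].
by move=> /andP[/IH1-> /IH2->].
Qed.

Lemma loops_le_agree B s s' c : agree s s' -> static c -> loops_le B s c -> loops_le B s' c.
Proof.
move=> ss'; elim: c => //= [c1 IH1 c2 IH2 /andP[/IH1 I1 /IH2 I2] /andP[/I1-> /I2->]//|e c IH].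
by move=> /andP[ce /IH I] /andP[le /I->]; rewrite (eval_agree ss' ce) le.
Qed.

Lemma cost_static B c s : 0 < B -> static c -> loops_le B s c -> cost c s <= weight c * B ^ depth c.
Proof.
move=> B0; elim: c s => /= [|r e|a i e|e|c1 IH1 c2 IH2|e c IH|e c IH] s; rewrite ?expn0 ?muln1 //.
- move=> /andP[st1 st2] /andP[l1 l2]; rewrite mulnDl; apply: leq_add.
    by rewrite (leq_trans (IH1 _ st1 l1)) // leq_mul2l leq_pexp2l ?leq_maxl ?orbT.
  rewrite (leq_trans (IH2 _ st2 (loops_le_agree (static_agree s st1) st2 l2))) //.
  by rewrite leq_mul2l leq_pexp2l ?leq_maxr ?orbT.
- move=> st l; rewrite mulnDl; apply: leq_add; first by rewrite leq_pmulr // expn_gt0 B0.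
  by case: eqP => // _; apply: IH.
- move=> /andP[ce st] /andP[le l]; rewrite mulnDl; apply: leq_add;
  first by rewrite leq_pmulr // expn_gt0 B0.
  apply: (@leq_trans (\sum_(k < eval s e) (weight c + 5) * B ^ depth c)).
    apply: leq_sum => k _; rewrite mulnDl; apply: leq_add.
      apply: IH => //; apply: loops_le_agree l => //.
      by apply: iter_agree => s'; apply: static_agree.
    by rewrite leq_pmulr // expn_gt0 B0.
  by rewrite sum_nat_const card_ord expnS mulnCA leq_mul2l leq_mul2r le !orbT.
Qed.

(** Keeps the bound of the outermost loop apart from [B]: in the application it is the exponential
    number of row sequences, while all inner loops are polynomially bounded. *)
Lemma cost_loop_static B e c s : 0 < B -> static c -> loops_le B s c ->
  cost (Loop e c) s <= ecost e + 1 + eval s e * (weight c * B ^ depth c + 5).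
Proof.
move=> B0 st l /=; rewrite leq_add2l -[X in _ <= X * _](card_ord (eval s e)) -sum_nat_const.
apply: leq_sum => k _; rewrite leq_add2r; apply: cost_static => //.
apply: loops_le_agree l => //.
by apply: iter_agree => s'; apply: static_agree.
Qed.
End StaticCost.
End Sem.

(** * Compilation to the random access machine *)

(* Registers of the source language sit at even cells, temporaries (including the
   loop counters) at odd cells, all of them below K. *)
Definition usr r := 8 + 2 * r.
Definition tmp d := 9 + 2 * d.

Fixpoint csize (c : cmd) : nat :=
  match c with
  | Skip => 0
  | Asg _ e => ecost e + 2
  | Put _ i e => ecost i + ecost e + 7
  | Out e => ecost e + 1
  | Seq c1 c2 => csize c1 + csize c2
  | When e c => ecost e + 1 + csize c
  | Loop e c => ecost e + 1 + csize c + 5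
  end.

(* Cell i of array a < 8 is stored at address B + 8 i + a, where B is kept in cell 3. *)
Definition heap_addr (a d t : nat) : seq instr :=
  [:: IADD d d d; IADD d d d; IADD d d d; IADD d d 3; ICONST t a; IADD d d t].

Arguments tmp : simpl never.
Arguments usr : simpl never.

Section Compile.
Variable K : nat.

(** For [Inp], memory from the limit in cell 4 onwards may hold saved cells and arrays, so reads
    there return the 0 preloaded in [tmp d.+2]. Addresses below [K] are shifted by cell 2 to the
    relocated copy; the others are read in place. *)
Fixpoint cexp (e : exp) (d pos : nat) : seq instr :=
  match e with
  | Const k => [:: ICONST (tmp d) k]
  | Reg r => [:: ICONST (tmp d) 0; IADD (tmp d) (tmp d) (usr r)]
  | Plus e1 e2 => cexp e1 d pos ++ cexp e2 d.+1 (pos + ecost e1) ++ [:: IADD (tmp d) (tmp d)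
    (tmp d.+1)]
  | Minus e1 e2 => cexp e1 d pos ++ cexp e2 d.+1 (pos + ecost e1) ++ [:: ISUB (tmp d) (tmp d)
    (tmp d.+1)]
  | Get a e => cexp e d pos ++ heap_addr a (tmp d) (tmp d.+1) ++ [:: ILOAD (tmp d) (tmp d)]
  | Inp e =>
      let l := pos + ecost e in
      cexp e d pos ++
      [:: ISUB (tmp d.+1) 4 (tmp d); ICONST (tmp d.+2) 0; IJZ (tmp d.+1) (l + 8);
          ICONST (tmp d.+1) K; ISUB (tmp d.+1) (tmp d.+1) (tmp d); IJZ (tmp d.+1) (l + 7);
          IADD (tmp d) (tmp d) 2; ILOAD (tmp d.+2) (tmp d);
          ICONST (tmp d) 0; IADD (tmp d) (tmp d) (tmp d.+2)]
  end.

(** The only jump is on zero, so [Loop] becomes a test on entry followed by a repeat-until: the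
    truncated difference of 1 and the counter is zero exactly while rounds remain, and then [IJZ]
    jumps back. *)
Fixpoint ccmd (c : cmd) (d pos : nat) : seq instr :=
  match c with
  | Skip => [::]
  | Asg r e => cexp e d pos ++ [:: ICONST (usr r) 0; IADD (usr r) (usr r) (tmp d)]
  | Put a i e => cexp i d pos ++ cexp e d.+1 (pos + ecost i) ++
      heap_addr a (tmp d) (tmp d.+2) ++ [:: ISTORE (tmp d) (tmp d.+1)]
  | Out e => cexp e d pos ++ [:: IOUT (tmp d)]
  | Seq c1 c2 => ccmd c1 d pos ++ ccmd c2 d (pos + csize c1)
  | When e c => cexp e d pos ++ IJZ (tmp d) (pos + ecost e + 1 + csize c) ::
      ccmd c d (pos + ecost e + 1)
  | Loop e c => cexp e d pos ++ IJZ (tmp d) (pos + ecost e + 1 + csize c + 5) ::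
      ccmd c d.+1 (pos + ecost e + 1) ++
      [:: ICONST (tmp d.+1) 1; ISUB (tmp d) (tmp d) (tmp d.+1);
          ICONST (tmp d.+1) 1; ISUB (tmp d.+1) (tmp d.+1) (tmp d);
          IJZ (tmp d.+1) (pos + ecost e + 1)]
  end.

Lemma size_cexp e d pos : size (cexp e d pos) = ecost e.
Proof.
elim: e d pos => //= [e1 IH1 e2 IH2|e1 IH1 e2 IH2|a e IH|e IH] d pos;
  rewrite size_cat ?size_cat /= ?IH1 ?IH2 ?IH //; lia.
Qed.

Lemma size_ccmd c d pos : size (ccmd c d pos) = csize c.
Proof.
elim: c d pos => //= [r e|a i e|e|c1 IH1 c2 IH2|e c IH|e c IH] d pos;
  rewrite ?size_cat /= ?size_cat /= ?size_cat ?size_cexp ?IH1 ?IH2 ?IH /=; lia.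
Qed.

Fixpoint wfe (e : exp) d : bool :=
  match e with
  | Const k => tmp d < K
  | Reg r => (usr r < K) && (tmp d < K)
  | Plus e1 e2 | Minus e1 e2 => wfe e1 d && wfe e2 d.+1
  | Get a e => [&& a < 8, wfe e d & tmp d.+1 < K]
  | Inp e => wfe e d && (tmp d.+2 < K)
  end.

Fixpoint wfc (c : cmd) d : bool :=
  match c with
  | Skip => true
  | Asg r e => (usr r < K) && wfe e d
  | Put a i e => [&& a < 8, wfe i d, wfe e d.+1 & tmp d.+2 < K]
  | Out e => wfe e d
  | Seq c1 c2 => wfc c1 d && wfc c2 d
  | When e c => wfe e d && wfc c d
  | Loop e c => [&& wfe e d, wfc c d.+1 & tmp d.+1 < K]
  end.

Lemma wfe_tmp e d : wfe e d -> tmp d < K.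
Proof.
elim: e d => //= [r|e1 IH1 e2 _|e1 IH1 e2 _|a e IH|e IH] d.
- by case/andP.
- by case/andP => /IH1.
- by case/andP => /IH1.
- by case/and3P => _ /IH.
- by case/andP => /IH.
Qed.

(** Temporaries form a stack: an operand or loop counter in [tmp d] survives code compiled at level
    [d.+1]. Parity separates them from the source registers. *)
Definition keep d (M M' : nat -> nat) := forall x, ~ (odd x /\ tmp d <= x < K) -> M' x = M x.

Lemma keep_refl d M : keep d M M. Proof. by []. Qed.

Lemma keep_trans d1 d M1 M2 M3 : d <= d1 -> keep d M1 M2 -> keep d1 M2 M3 -> keep d M1 M3.
Proof.
move=> le H1 H2 x Hx; rewrite H2 ?H1 // => -[ox lx]; apply: Hx; split => //.
move: lx; rewrite /tmp; lia.
Qed.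

Lemma keep_upd d d' M v : d <= d' -> tmp d' < K -> keep d M (upd M (tmp d') v).
Proof.
move=> le lt x Hx; rewrite /upd; case: eqP => // ex; case: Hx; rewrite {}ex; move: lt;
  rewrite /tmp; split; lia.
Qed.

Lemma keep_updr d d' M M' v : keep d M M' -> d <= d' -> tmp d' < K -> keep d M (upd M' (tmp d') v).
Proof. by move=> kM le lt; apply: (keep_trans (leqnn d) kM); apply: keep_upd. Qed.

Lemma keepS d M M' : keep d.+1 M M' -> keep d M M'.
Proof. by move=> kM; exact: (keep_trans (leqnSn d) (@keep_refl _ _) kM). Qed.

Lemma keep_tmp d d' M M' : keep d M M' -> d' < d -> M' (tmp d') = M (tmp d').
Proof. by move=> H lt; apply: H => -[_]; rewrite /tmp; lia. Qed.

Section Run.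
Variable P : seq instr.

Fixpoint run t s := if t is t'.+1 then (if step P s is Some s' then run t' s' else None) else
  Some s.

Definition reach c s s' := exists2 t, t <= c & run t s = Some s'.

Lemma run_add t1 t2 s s' : run t1 s = Some s' -> run (t1 + t2) s = run t2 s'.
Proof. by elim: t1 s => /= [s [->]//|t IH s]; case: step => // s2 /IH. Qed.

Lemma run_exec t s s' : run t s = Some s' -> step P s' = None -> exec P t.+1 s = Some s'.
Proof.
elim: t s => [s [->] /= -> //|t IH s]; rewrite [run _ _]/= [exec _ _ _]/=.
by case: (step P s) => // s2 /IH H /H.
Qed.

Lemma reach_refl s : reach 0 s s.
Proof. by exists 0. Qed.

Lemma reach_trans c1 c2 s1 s2 s3 : reach c1 s1 s2 -> reach c2 s2 s3 -> reach (c1 + c2) s1 s3.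
Proof.
by move=> [t1 l1 r1] [t2 l2 r2]; exists (t1 + t2); [exact: leq_add | rewrite (run_add _ r1)].
Qed.

Lemma reach_weak c c' s s' : c <= c' -> reach c s s' -> reach c' s s'.
Proof. by move=> le [t lt r]; exists t => //; apply: leq_trans le. Qed.

Lemma reach_step c s s' s'' : step P s = Some s' -> reach c s' s'' -> reach c.+1 s s''.
Proof. by move=> st [t lt r]; exists t.+1 => //=; rewrite st. Qed.

Definition code_at pos c := forall i, i < size c -> nth IHALT P (pos + i) = nth IHALT c i.

Lemma code_at_cat pos c1 c2 :
  code_at pos (c1 ++ c2) -> code_at pos c1 /\ code_at (pos + size c1) c2.
Proof.
move=> H; split=> i lti; first by rewrite H ?nth_cat ?lti // size_cat ltn_addr.
by rewrite -addnA H ?nth_cat ?size_cat ?ltn_add2l // ltnNge leq_addr /= addKn.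
Qed.

Lemma code_at_cons pos i c : code_at pos (i :: c) -> nth IHALT P pos = i /\ code_at pos.+1 c.
Proof.
by move=> H; split=> [|j ltj]; [have := H 0 isT; rewrite addn0 | rewrite addSnnS H].
Qed.

Definition straight (i : instr) := match i with IJZ _ _ | IHALT | IOUT _ => false | _ => true end.

Definition eff (M : nat -> nat) (i : instr) :=
  match i with
  | ICONST r k => upd M r k
  | IADD r a b => upd M r (M a + M b)
  | ISUB r a b => upd M r (M a - M b)
  | ILOAD r a => upd M r (M (M a))
  | ISTORE a r => upd M (M a) (M r)
  | _ => M
  end.

Lemma reach_straight c pos M o : code_at pos c -> all straight c ->
  reach (size c) (St pos M o) (St (pos + size c) (foldl eff M c) o).
Proof.
elim: c pos M => [|i c IH] pos M; first by rewrite addn0; exists 0.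
move=> /code_at_cons[ni /IH{}IH] /= /andP[si sc].
apply: (@reach_step _ _ (St pos.+1 (eff M i) o)); first by rewrite /step /= ni; case: i si {ni IH}.
by rewrite addnS -addSn; apply: IH.
Qed.

Lemma reach_jz pos r l M o : nth IHALT P pos = IJZ r l ->
  reach 1 (St pos M o) (St (if M r == 0 then l else pos.+1) M o).
Proof. by move=> H; exists 1 => //=; rewrite /step /= H. Qed.

Section Simulation.
Variables (inp : nat -> nat) (p B lim : nat).
Hypotheses (leKp : K <= p) (lepB : p + K <= B) (leLB : lim <= B).
Hypothesis inp0 : forall x, lim <= x -> inp x = 0.

(* The input stays in place, except for its cells below K, which were moved to
   p, ..., p + K - 1. *)
Record rel (M : nat -> nat) (s : lst) : Prop := Rel {
  rel2 : M 2 = p; rel3 : M 3 = B; rel4 : M 4 = lim;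
  rel_inp : forall x, x < lim -> M (if x < K then p + x else x) = inp x;
  rel_usr : forall r, usr r < K -> M (usr r) = rg s r;
  rel_hp : forall a i, a < 8 -> M (B + 8 * i + a) = hp s a i }.

Lemma rel_keep d M M' s : keep d M M' -> rel M s -> rel M' s.
Proof.
move=> H R; split; rewrite ?H ?(rel2 R) ?(rel3 R) ?(rel4 R) //; try by case=> _; rewrite /tmp; lia.
- move=> x lx; rewrite H ?(rel_inp R) //.
  by case=> _; case: ifP => ltx; rewrite /tmp; lia.
- by move=> r lr; rewrite H ?(rel_usr R) // => -[]; rewrite /usr; lia.
- by move=> a i la; rewrite H ?(rel_hp R) // => -[]; lia.
Qed.


Lemma heap_addr_val a d t M : d != 3 -> t != d -> foldl eff M (heap_addr a d t) d =
  8 * M d + M 3 + a.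
Proof.
move=> d3 td; rewrite /= /upd !eqxx eq_sym (negbTE td) [3 == d]eq_sym (negbTE d3); lia.
Qed.

Lemma heap_addr_keep a d t M x : x <> d -> x <> t -> foldl eff M (heap_addr a d t) x = M x.
Proof. by move=> /eqP/negbTE xd /eqP/negbTE xt; rewrite /= /upd xd xt. Qed.

Lemma cexp_correct e d pos M s o : code_at pos (cexp e d pos) -> wfe e d -> rel M s ->
  exists M', [/\ reach (ecost e) (St pos M o) (St (pos + ecost e) M' o),
                keep d M M' & M' (tmp d) = eval inp s e].
Proof.
elim: e d pos M => [k|r|e1 IH1 e2 IH2|e1 IH1 e2 IH2|a e IH|e IH] d pos M.
- move=> /reach_straight H ltd _; exists (upd M (tmp d) k); split; first exact: H.
    exact: keep_upd.
  by rewrite /upd eqxx.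
- move=> /reach_straight H /andP[ltr ltd] R; eexists; split; first exact: H.
    by rewrite /=; do 2?apply: keep_updr.
  rewrite /= /upd eqxx -(rel_usr R ltr); case: eqP => // /eqP; rewrite /usr /tmp; lia.
- move=> /code_at_cat[c1 /code_at_cat[c2]]; rewrite !size_cexp in c2 * => c3.
  move=> /andP[w1 w2] R; have [M1 [r1 k1 v1]] := IH1 _ _ _ c1 w1 R.
  have [M2 [r2 k2 v2]] := IH2 _ _ _ c2 w2 (rel_keep k1 R).
  have r3 := reach_straight M2 o c3 isT.
  eexists; split.
  + have := reach_trans r1 (reach_trans r2 r3).
    by rewrite /= !addnA; apply.
  + apply: keep_updr (leqnn d) (wfe_tmp w1).
    exact: (keep_trans (leqnn d) k1 (keepS k2)).
  + by rewrite /= /upd eqxx (keep_tmp k2) // v1 v2.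
- move=> /code_at_cat[c1 /code_at_cat[c2]]; rewrite !size_cexp in c2 * => c3.
  move=> /andP[w1 w2] R; have [M1 [r1 k1 v1]] := IH1 _ _ _ c1 w1 R.
  have [M2 [r2 k2 v2]] := IH2 _ _ _ c2 w2 (rel_keep k1 R).
  have r3 := reach_straight M2 o c3 isT.
  eexists; split.
  + have := reach_trans r1 (reach_trans r2 r3).
    by rewrite /= !addnA; apply.
  + apply: keep_updr (leqnn d) (wfe_tmp w1).
    exact: (keep_trans (leqnn d) k1 (keepS k2)).
  + by rewrite /= /upd eqxx (keep_tmp k2) // v1 v2.
- move=> /code_at_cat[c1]; rewrite size_cexp => c2.
  move=> /and3P[lta w ltd] R; have [M1 [r1 k1 v1]] := IH _ _ _ c1 w R.
  have r2 := reach_straight M1 o c2 isT.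
  have R1 := rel_keep k1 R; have ltd0 := wfe_tmp w.
  rewrite foldl_cat in r2; set M2 := foldl eff M1 (heap_addr _ _ _) in r2.
  have v2 : M2 (tmp d) = 8 * M1 (tmp d) + M1 3 + a by apply: heap_addr_val; rewrite /tmp; lia.
  have k2 x : x <> tmp d -> x <> tmp d.+1 -> M2 x = M1 x by apply: heap_addr_keep.
  eexists; split.
  + by have := reach_trans r1 r2; rewrite -addnA; apply.
  + apply: (keep_trans (leqnn d) k1); apply: keep_updr => // x Hx; apply: k2 => ex; apply: Hx.
      by rewrite ex; move: ltd0; rewrite /tmp; lia.
    by rewrite ex; move: ltd; rewrite /tmp; lia.
  + rewrite /= /upd eqxx v2 v1 (rel3 R1) -(rel_hp R1 _ lta) [8 * _ + B]addnC.
    by apply: k2; move: leKp lepB ltd ltd0; rewrite /tmp; lia.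
- move=> /code_at_cat[c1]; rewrite size_cexp => c2.
  move=> /andP[w ltd2] R; have [M1 [r1 k1 v1]] := IH _ _ _ c1 w R.
  have R1 := rel_keep k1 R; have ltd0 := wfe_tmp w.
  have ltd1 : tmp d.+1 < K by move: ltd2; rewrite /tmp; lia.
  set l := pos + ecost e in c2 r1; set i := eval inp s e in v1.
  pose M2 := upd (upd M1 (tmp d.+1) (lim - i)) (tmp d.+2) 0.
  have k2 : keep d M1 M2.
    by do 2?apply: keep_updr => //; lia.
  (* The three paths of a read meet at [l + 8] with the value in [tmp d.+2]; the common tail is run
     once here. *)
  have fin M3 v : keep d M1 M3 -> M3 (tmp d.+2) = v -> inp i = v ->
     reach 8 (St l M1 o) (St (l + 8) M3 o) ->
     exists M', [/\ reach (ecost e + 10) (St pos M o) (St (pos + (ecost e + 10)) M' o),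
                keep d M M' & M' (tmp d) = inp i].
    move=> k3 v3 iv r3.
    have c4 : code_at (l + 8) [:: ICONST (tmp d) 0; IADD (tmp d) (tmp d) (tmp d.+2)].
      by move=> [|[|j]] // ?; rewrite -addnA c2.
    have r4 := reach_straight M3 o c4 isT.
    eexists; split.
    + by have := reach_trans r1 (reach_trans r3 r4); rewrite -[l + 8 + _]addnA /l -addnA; apply.
    + apply: (keep_trans (leqnn d) k1); apply: (keep_trans (leqnn d) k3).
      by do 2?apply: keep_updr.
    + rewrite /= /upd !eqxx; case: eqP => [|_]; first by rewrite /tmp; lia.
      by rewrite v3 iv.
  have r2 : reach 2 (St l M1 o) (St (l + 2) M2 o).
    have c3 : code_at l [:: ISUB (tmp d.+1) 4 (tmp d); ICONST (tmp d.+2) 0].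
      by move=> [|[|j]] // ?; rewrite c2.
    by have := reach_straight M1 o c3 isT; rewrite /= (rel4 R1) v1.
  have M2d1 : M2 (tmp d.+1) = lim - i.
    by rewrite /M2 /upd eqxx; case: eqP => //; rewrite /tmp; lia.
  have r3 := @reach_jz (l + 2) (tmp d.+1) (l + 8) M2 o (c2 2 isT).
  have [lei|gti] := leqP lim i.
    apply: (fin M2 0) => //; first by rewrite /M2 /upd eqxx.
      exact: inp0.
    move: r3; rewrite M2d1 (eqP (_ : lim - i == 0)) ?subn_eq0 // => r3.
    by apply: reach_weak (reach_trans r2 r3).
  rewrite M2d1 (negbTE (_ : lim - i != 0)) -?lt0n ?subn_gt0 // in r3.
  pose M3 := foldl eff M2 [:: ICONST (tmp d.+1) K; ISUB (tmp d.+1) (tmp d.+1) (tmp d)].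
  have r4 : reach 2 (St (l + 2).+1 M2 o) (St (l + 5) M3 o).
    rewrite (_ : l + 5 = (l + 2).+1 + 2); last by lia.
    have c3 : code_at (l + 2).+1 [:: ICONST (tmp d.+1) K; ISUB (tmp d.+1) (tmp d.+1) (tmp d)].
      by move=> [|[|j]] // ?; rewrite -addnS -addnA c2.
    exact: (reach_straight M2 o c3 isT).
  have k3 : keep d M1 M3 by do 2?apply: keep_updr.
  have dd1 : (tmp d == tmp d.+1) = false by rewrite /tmp; lia.
  have dd2 : (tmp d == tmp d.+2) = false by rewrite /tmp; lia.
  have M2d : M2 (tmp d) = i by rewrite /M2 /upd dd2 dd1.
  have M3d : M3 (tmp d) = i by rewrite /M3 [foldl _ _ _]/= /upd dd1 M2d.
  have M3d1 : M3 (tmp d.+1) = K - i by rewrite /M3 [foldl _ _ _]/= /upd !eqxx dd1 M2d.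
  have R3 := rel_keep k3 R1; have := rel_inp R3 gti.
  have r5 := @reach_jz (l + 5) (tmp d.+1) (l + 7) M3 o (c2 5 isT).
  have [leKi|ltiK] := leqP K i => inpi.
    apply: (fin (upd M3 (tmp d.+2) (M3 (M3 (tmp d)))) (inp i)).
    + by apply: keep_updr => //; lia.
    + by rewrite /upd eqxx M3d inpi.
    + by [].
    have r6 : reach 1 (St (l + 7) M3 o) (St (l + 8) (upd M3 (tmp d.+2) (M3 (M3 (tmp d)))) o).
      rewrite (_ : l + 8 = l + 7 + 1); last by lia.
      have c3 : code_at (l + 7) [:: ILOAD (tmp d.+2) (tmp d)] by move=> [|j] // ?;
        rewrite -addnA c2.
      exact: (reach_straight M3 o c3 isT).
    rewrite M3d1 (eqP (_ : K - i == 0)) ?subn_eq0 // in r5.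
    by apply: reach_weak (reach_trans r2 (reach_trans r3 (reach_trans r4 (reach_trans r5 r6)))).
  pose M4 := foldl eff M3 [:: IADD (tmp d) (tmp d) 2; ILOAD (tmp d.+2) (tmp d)].
  apply: (fin M4 (inp i)).
  + by do 2?apply: keep_updr => //; lia.
  + rewrite /M4 /= /upd !eqxx M3d (rel2 R3) -inpi addnC; case: eqP => // ex.
    by move: leKp ltd0; rewrite -ex; lia.
  + by [].
  have r6 : reach 2 (St (l + 5).+1 M3 o) (St (l + 8) M4 o).
    rewrite (_ : l + 8 = (l + 5).+1 + 2); last by lia.
    have c3 : code_at (l + 5).+1 [:: IADD (tmp d) (tmp d) 2; ILOAD (tmp d.+2) (tmp d)].
      by move=> [|[|j]] // ?; rewrite -addnS -addnA c2.
    exact: (reach_straight M3 o c3 isT).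
  rewrite M3d1 (negbTE (_ : K - i != 0)) -?lt0n ?subn_gt0 // in r5.
  by apply: reach_weak (reach_trans r2 (reach_trans r3 (reach_trans r4 (reach_trans r5 r6)))).
Qed.

Lemma rel_asg M M' s r v : rel M s -> usr r < K -> M' (usr r) = v ->
  (forall x, x <> usr r -> M' x = M x) -> rel M' (LS (upd (rg s) r v) (hp s) (ou s)).
Proof.
move=> R lt Mv Mo; have lt' := lt; rewrite /usr in lt'.
split => /=; rewrite ?Mo ?(rel2 R) ?(rel3 R) ?(rel4 R) //; try by rewrite /usr; lia.
- by move=> x lx; rewrite Mo ?(rel_inp R) //; case: ifP; rewrite /usr; lia.
- move=> r' lr; rewrite /upd; case: eqP => [-> //|ne]; rewrite Mo ?(rel_usr R) // /usr; lia.
- by move=> a i la; rewrite Mo ?(rel_hp R) //; rewrite /usr; lia.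
Qed.

Lemma rel_put M s a i v : rel M s -> a < 8 -> 8 < K ->
  rel (upd M (B + 8 * i + a) v) (LS (rg s) (updh (hp s) a (upd (hp s a) i v)) (ou s)).
Proof.
move=> R la K8.
have neq x : x < B -> upd M (B + 8 * i + a) v x = M x by move=> lx; rewrite /upd;
  case: eqP => // ex; lia.
split => /=; rewrite ?neq ?(rel2 R) ?(rel3 R) ?(rel4 R) //; try by lia.
- by move=> x lx; rewrite neq ?(rel_inp R) //; case: ifP; lia.
- by move=> r lr; rewrite neq ?(rel_usr R) //; lia.
- move=> a' i' la'; rewrite /upd /updh; case: (a' =P a) => [->|ne]; last by case: eqP => [|_];
  [lia | exact: rel_hp].
  by case: eqP => [e|ne]; case: eqP => // e'; rewrite ?(rel_hp R) //; lia.
Qed.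

Lemma rel_ou M s o : rel M s -> rel M (LS (rg s) (hp s) o).
Proof. by case=> *; split. Qed.

Lemma ccmd_correct c d pos M s : 8 < K -> code_at pos (ccmd c d pos) -> wfc c d -> rel M s ->
  exists M', [/\ reach (cost inp c s) (St pos M (ou s)) (St (pos + csize c) M' (ou (sem inp c s))),
                forall d', d' < d -> M' (tmp d') = M (tmp d') & rel M' (sem inp c s)].
Proof.
move=> K8; elim: c d pos M s => [|r e|a i e|e|c1 IH1 c2 IH2|e c IH|e c IH] d pos M s.
- by move=> _ _ R; exists M; split => //=; rewrite addn0; exact: reach_refl.
- move=> /code_at_cat[c1]; rewrite size_cexp => c2 /andP[ltr w] R.
  have [M1 [r1 k1 v1]] := cexp_correct (ou s) c1 w R.
  have r2 := reach_straight M1 (ou s) c2 isT.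
  eexists; split.
  + by have := reach_trans r1 r2; rewrite -addnA; apply.
  + move=> d' lt; rewrite /= /upd (_ : (tmp d' == usr r) = false) ?(keep_tmp k1) //.
    by rewrite /tmp /usr; lia.
  + apply: (rel_asg (rel_keep k1 R) ltr) => [|x /eqP/negbTE ne]; last by rewrite /= /upd ne.
    by rewrite /= /upd !eqxx (_ : (tmp d == usr r) = false) // /tmp /usr; lia.
- move=> /code_at_cat[c1 /code_at_cat[c2]];
  rewrite !size_cexp in c2 * => c3 /and4P[la w1 w2 ltd2] R.
  have [M1 [r1 k1 v1]] := cexp_correct (ou s) c1 w1 R.
  have R1 := rel_keep k1 R.
  have [M2 [r2 k2 v2]] := cexp_correct (ou s) c2 w2 R1.
  have R2 := rel_keep k2 R1.
  have r3 := reach_straight M2 (ou s) c3 isT.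
  rewrite foldl_cat in r3; set M3 := foldl eff M2 (heap_addr _ _ _) in r3.
  have v3 : M3 (tmp d) = 8 * M2 (tmp d) + M2 3 + a by apply: heap_addr_val; rewrite /tmp; lia.
  have k3' x : x <> tmp d -> x <> tmp d.+2 -> M3 x = M2 x by apply: heap_addr_keep.
  have k3 : keep d M2 M3.
    have ltd := wfe_tmp w1; move=> x Hx; apply: k3' => ex; apply: Hx; rewrite ex;
      move: ltd ltd2; rewrite /tmp; lia.
  have adr : M3 (tmp d) = B + 8 * eval inp s i + a.
    by rewrite v3 (rel3 R2) (keep_tmp k2) // v1; lia.
  have val : M3 (tmp d.+1) = eval inp s e.
    by rewrite k3' ?v2 // /tmp; lia.
  rewrite [foldl _ _ [:: _]]/= adr val in r3.
  have ep : pos + ecost i + ecost e + 7 = pos + csize (Put a i e) by rewrite /= !addnA.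
  rewrite ep in r3; exists (upd M3 (B + 8 * eval inp s i + a) (eval inp s e)); split.
  + by apply: reach_weak (reach_trans r1 (reach_trans r2 r3)); rewrite /= addnA.
  + move=> d' lt; rewrite /upd (_ : (tmp d' == _) = false).
      by rewrite (keep_tmp k3) // (keep_tmp k2) ?(keep_tmp k1) // ltnW.
    by have ltd := wfe_tmp w1; move: leKp lepB ltd lt; rewrite /tmp; lia.
  + by apply: rel_put => //; exact: rel_keep k3 R2.
- move=> /code_at_cat[c1]; rewrite size_cexp => /code_at_cons[c2 _] w R.
  have [M1 [r1 k1 v1]] := cexp_correct (ou s) c1 w R.
  exists M1; split; last exact/rel_ou/(rel_keep k1).
    rewrite /= addnA -v1; apply: reach_trans r1 _.
    by exists 1 => //=; rewrite /step /= c2 addn1.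
  by move=> d' lt; rewrite (keep_tmp k1).
- move=> /code_at_cat[a1]; rewrite size_ccmd => a2 /andP[w1 w2] R.
  have [M1 [r1 k1 R1]] := IH1 _ _ _ _ a1 w1 R.
  have [M2 [r2 k2 R2]] := IH2 _ _ _ _ a2 w2 R1.
  exists M2; split => //=; first by rewrite addnA; apply: reach_trans r1 r2.
  by move=> d' lt; rewrite k2 // k1.
- move=> /code_at_cat[c1]; rewrite size_cexp => /code_at_cons[c2 c3] /andP[w1 w2] R.
  have [M1 [r1 k1 v1]] := cexp_correct (ou s) c1 w1 R.
  have R1 := rel_keep k1 R; have r2 := reach_jz M1 (ou s) c2.
  rewrite v1 in r2; rewrite /=; case: eqP r2 => e0 r2.
    exists M1; split => //; last by move=> d' lt; rewrite (keep_tmp k1).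
    by rewrite addn0 !addnA; exact: reach_trans r1 r2.
  rewrite -[(pos + _).+1]addn1 in c3; have [M2 [r3 k3 R3]] := IH _ _ _ _ c3 w2 R1.
  exists M2; split => //; last by move=> d' lt; rewrite k3 // (keep_tmp k1).
  rewrite -[(pos + _).+1]addn1 in r2.
  by rewrite !addnA; exact: reach_trans (reach_trans r1 r2) r3.
move=> /code_at_cat[c1]; rewrite size_cexp => /code_at_cons[c2 /code_at_cat[c3]].
rewrite size_ccmd -[(pos + _).+1]addn1 in c3 * => c4 /and3P[w1 w2 ltd1] R.
set l1 := pos + ecost e + 1 in c3 c4; set l2 := l1 + csize c in c4.
have dd1 : (tmp d == tmp d.+1) = false by rewrite /tmp; lia.
(* One round entered with counter [n.+1]. It leaves [n] in the counter and either exits behind the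
   loop or returns to [l1]. *)
have step n M0 s0 : rel M0 s0 -> M0 (tmp d) = n.+1 ->
  exists M', [/\ reach (cost inp c s0 + 5) (St l1 M0 (ou s0)) (St (if n == 0 then l2 + 5 else
    l1) M' (ou (sem inp c s0))),
                forall d', d' < d -> M' (tmp d') = M0 (tmp d'), M' (tmp d) = n &
                  rel M' (sem inp c s0)].
  move=> R0 n0; have [M1 [r1 k1 R1]] := IH _ _ _ _ c3 w2 R0.
  have c4' : code_at l2 [:: ICONST (tmp d.+1) 1; ISUB (tmp d) (tmp d) (tmp d.+1);
      ICONST (tmp d.+1) 1; ISUB (tmp d.+1) (tmp d.+1) (tmp d)] by move=> [|[|[|[|j]]]] // ?;
        rewrite c4.
  have r2 := reach_straight M1 (ou (sem inp c s0)) c4' isT.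
  set M2 := foldl _ _ _ in r2.
  have k2 : keep d M1 M2 by do 4?apply: keep_updr => //; exact: wfe_tmp w1.
  have M2d : M2 (tmp d) = n.
    by rewrite /M2 [foldl _ _ _]/= /upd !eqxx dd1 k1 // n0 subn1.
  have M2d1 : M2 (tmp d.+1) = 1 - n.
    have d1d : (tmp d.+1 == tmp d) = false by rewrite eq_sym.
    by rewrite -M2d /M2 [foldl _ _ _]/= /upd !(eqxx, dd1, d1d).
  have := @reach_jz (l2 + 4) (tmp d.+1) l1 M2 (ou (sem inp c s0)) (c4 4 isT).
  rewrite M2d1 -[(l2 + 4).+1]addnS => r3.
  exists M2; split => //; last exact: rel_keep k2 R1.
    rewrite (_ : 5 = 4 + 1) // -/l2; apply: (reach_trans r1); apply: (reach_trans r2).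
    by case: (n) r3.
  by move=> d' lt; rewrite (keep_tmp k2) // k1 // ltnW.
have loop n M0 s0 : rel M0 s0 -> M0 (tmp d) = n.+1 ->
  exists M', [/\ reach (\sum_(k < n.+1) (cost inp c (iter k (sem inp c) s0) + 5))
                   (St l1 M0 (ou s0)) (St (l2 + 5) M' (ou (iter n.+1 (sem inp c) s0))),
                forall d', d' < d -> M' (tmp d') = M0 (tmp d') & rel M' (iter n.+1 (sem inp c) s0)].
  elim: n M0 s0 => [|n IHn] M0 s0 R0 n0; have [M1 [r1 k1 M1d R1]] := step _ _ _ R0 n0.
    by exists M1; split => //; rewrite big_ord_recl big_ord0 addn0.
  have [M2 [r2 k2 R2]] := IHn _ _ R1 M1d.
  exists M2; split; last by rewrite iterSr.
    rewrite big_ord_recl iterSr; apply: reach_trans r1 _.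
    rewrite (eq_bigr (fun k : 'I_n.+1 =>
      cost inp c (iter k (sem inp c) (sem inp c s0)) + 5)) // => k _.
    by rewrite -iterSr.
  by move=> d' lt; rewrite k2 // k1.
have [M1 [r1 k1 v1]] := cexp_correct (ou s) c1 w1 R.
have R1 := rel_keep k1 R; have r2 := reach_jz M1 (ou s) c2.
rewrite v1 in r2; rewrite /= -/l1 -/l2.
case en : (eval inp s e) r2 => [|n] r2.
  exists M1; split => //; last by move=> d' lt; rewrite (keep_tmp k1).
  by rewrite big_ord0 addn0 /=; have := reach_trans r1 r2; rewrite -/l1 !addnA.
have [M2 [r3 k3 R3]] := loop n M1 s R1 (etrans v1 en).
exists M2; split => //; last by move=> d' lt; rewrite k3 // (keep_tmp k1).
rewrite -[(pos + _).+1]addn1 -/l1 in r2.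
by have := reach_trans (reach_trans r1 r2) r3; rewrite /l2 /l1 !addnA.
Qed.
End Simulation.
End Run.
End Compile.

(** * Relocation of the input *)

Section Prelude.
Variable K : nat.

(* Initially only cells 0 and 1 (n and the number m of edges) can be overwritten.
   The address n + (K + 3) m is computed in cell 0; it lies beyond the input and
   beyond K since m > 0, so the first K cells can be saved there. *)
Definition save_regs : seq instr := flatten [seq [:: IADD 0 0 1; ISTORE 0 r] | r <- iota 1 K.-1].

(** The lack of free cells dictates the order. Storing m at the new place frees cell 1 for the
    increment 1, and cells 2, 3, 4 and the source registers may be written only after the low cells
    are saved. The value [n] is never stored: it is recovered by subtracting (K + 3) m from the
    address. *)
Definition prelude : seq instr :=
  nseq (K + 3) (IADD 0 0 1) ++ [:: ISTORE 0 1; ICONST 1 1] ++ save_regs ++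
  [:: ICONST 1 K.-1; ISUB 2 0 1; ICONST 1 1; IADD 3 0 1; ILOAD (usr 1) 2;
      ICONST (usr 0) 0; IADD (usr 0) (usr 0) 2] ++
  nseq (K + 3) (ISUB (usr 0) (usr 0) (usr 1)) ++
  [:: ICONST 4 2; IADD 4 4 (usr 1); IADD 4 4 (usr 1); IADD 4 4 (usr 1)].

Lemma straight_prelude : all straight prelude.
Proof.
rewrite !all_cat !all_nseq /= !orbT andbT /save_regs.
by elim: (iota _ _).
Qed.

Lemma foldl_nseq_add M a b k : a != b -> let M' := foldl eff M (nseq k (IADD a a b)) in
  M' a = M a + k * M b /\ forall x, x <> a -> M' x = M x.
Proof.
move=> ab; elim: k M => [|k IH] M /=; first by rewrite addn0.
have [-> H] := IH (upd M a (M a + M b)); split => [|x ne].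
  by rewrite /upd eqxx eq_sym (negbTE ab) mulSn addnA.
by rewrite H // /upd; case: eqP.
Qed.

Lemma foldl_nseq_sub M a b k : a != b -> let M' := foldl eff M (nseq k (ISUB a a b)) in
  M' a = M a - k * M b /\ forall x, x <> a -> M' x = M x.
Proof.
move=> ab; elim: k M => [|k IH] M /=; first by rewrite subn0.
have [-> H] := IH (upd M a (M a - M b)); split => [|x ne].
  by rewrite /upd eqxx eq_sym (negbTE ab) mulSn subnDA.
by rewrite H // /upd; case: eqP.
Qed.

(** [j < q] keeps the sources 1, ..., j clear of the destinations, so every value copied is the
    original one. *)
Lemma foldl_save j q M : M 0 = q -> M 1 = 1 -> j < q ->
  let M' := foldl eff M (flatten [seq [:: IADD 0 0 1; ISTORE 0 r] | r <- iota 1 j]) in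
  M' 0 = q + j /\ forall x, x <> 0 -> M' x = if q < x <= q + j then M (x - q) else M x.
Proof.
move=> M0 M1; elim: j => [|j IH] lt.
  by split=> [|x] /=; rewrite addn0 // andbC; case: ltngtP.
have [H0 H] := IH (ltnW lt).
have := iotaD 1 j 1; rewrite addn1 => ->; rewrite map_cat flatten_cat foldl_cat /= add1n.
set M' := foldl eff M _ in H0 H *.
have H1 : M' 1 = 1 by rewrite H // M1; case: ifP => //; lia.
split=> [|x x0]; rewrite /upd /= H0 H1.
  by case: eqP => [e|_]; lia.
case: eqP => [->|ne].
  rewrite H //; case: ifP; first by lia.
  move=> _; rewrite (_ : _ && _ = true); last by lia.
  by congr (M _); lia.
move/eqP/negbTE: (x0) => ->; rewrite H //; congr (if _ then _ else _); lia.
Qed.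

Variables (n : nat) (Es : seq (seq 'I_n)).

(* Cells 0 and 1 of the input do not survive the relocation. *)
Definition inp x := if x < 2 then (if x == 0 then size Es else 1) else input_mem Es x.

Definition saved_at := n + (K + 3) * size Es.

Hypotheses (K11 : 10 < K) (Es0 : 0 < size Es).

Lemma lim_saved_at : 2 + 3 * size Es <= saved_at /\ K <= saved_at.
Proof. by rewrite /saved_at; move: (size Es) Es0 => m; split; nia. Qed.

Lemma prelude_correct : let M := foldl eff (input_mem Es) prelude in
  [/\ M (usr 0) = n, M (usr 1) = size Es &
  rel K inp saved_at (saved_at + K) (2 + 3 * size Es) M (LS (fun r => M (usr r)) (fun _ _ =>
    0) [::])].
Proof.
have [le1 le2] := lim_saved_at.
rewrite /prelude 5!foldl_cat; set M0 := input_mem Es.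
have [] := @foldl_nseq_add M0 0 1 (K + 3) isT; set M1 := foldl eff M0 _.
rewrite [M0 0]/= [M0 1]/= -/saved_at => M1p M1o.
set M2 := foldl eff M1 _.
have M2p : M2 0 = saved_at by rewrite /M2 /= /upd /= M1p; case: eqP => //; lia.
have [] := @foldl_save K.-1 saved_at M2 M2p erefl _; first by lia.
rewrite -/save_regs; set M3 := foldl eff M2 _ => M3p M3o.
have M2v x : M2 x = if x == 1 then 1 else if x == saved_at then size Es else M1 x.
  by rewrite /M2 /= /upd M1p M1o.
have M2in x : x <> 0 -> x <> 1 -> x <> saved_at -> M2 x = M0 x.
  by move=> x0 /eqP/negbTE x1 /eqP/negbTE xs; rewrite M2v x1 xs M1o.
have inpE x : x <> 0 -> x <> 1 -> inp x = M0 x by case: x => [|[|x]].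
have M3in x : x < 2 + 3 * size Es -> M3 (if x < K then saved_at + x else x) = inp x.
  move=> ltx; have [ltK|leK] := ltnP x K.
    rewrite M3o; last by lia.
    case: (posnP x) => [->|x0].
      rewrite (_ : _ && _ = false); last by lia.
      rewrite addn0 M2v eqxx; case: eqP => //; lia.
    rewrite (_ : _ && _ = true); last by lia.
    rewrite addKn; case: (x =P 1) => [->|x1]; first by rewrite M2v.
    by rewrite M2in ?inpE //; lia.
  rewrite M3o; last by lia.
  rewrite (_ : _ && _ = false); last by lia.
  by rewrite M2in ?inpE //; lia.
(* Everything past the saved cells is still blank, so all arrays start out as zero. *)
have M3z x : saved_at + K <= x -> M3 x = 0.
  move=> lex; rewrite M3o; last by lia.
  rewrite (_ : _ && _ = false); last by lia.
  rewrite M2in; try by lia.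
  rewrite /M0 /input_mem; case: eqP => [|_]; first by lia.
  case: eqP => [|_]; first by lia.
  by case: ltnP => //; lia.
set M4 := foldl eff M3 _.
have M4v : forall x, M4 x = if x == 8 then saved_at else if x == 10 then size Es
    else if x == 3 then saved_at + K else if x == 1 then 1 else if x == 2 then saved_at else M3 x.
  move=> x; rewrite /M4 /= /upd /usr /= !add0n M3p.
  have -> : saved_at + K.-1 - K.-1 = saved_at by lia.
  have -> : saved_at + K.-1 + 1 = saved_at + K by lia.
  have ps y : y <= 10 -> (saved_at == y) = false by lia.
  rewrite !ps //.
  have := M3in 0 isT; rewrite (_ : 0 < K = true) ?addn0; last by lia.
  by move=> ->; case: (x == 8); case: (x == 10); case: (x == 1).
have [] := @foldl_nseq_sub M4 (usr 0) (usr 1) (K + 3) isT; set M5 := foldl eff M4 _ => M5n M5o.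
rewrite !M4v /= /saved_at addnK in M5n.
have M5v x : x <> 8 -> M5 x = M4 x := M5o x.
have M6v : forall x, foldl eff M5 [:: ICONST 4 2; IADD 4 4 (usr 1); IADD 4 4 (usr 1);
  IADD 4 4 (usr 1)] x
    = if x == 4 then 2 + 3 * size Es else M5 x.
  by move=> x; rewrite /= /upd /= M5v // M4v /=; case: eqP => // _; lia.
move: (foldl _ M5 _) M6v => M6 M6v.
split; [by rewrite M6v M5n | by rewrite M6v /= M5v // M4v |].
split=> /=; rewrite ?M6v /= ?M5v ?M4v //.
- move=> x ltx; rewrite -M3in //.
  have : 10 < (if x < K then saved_at + x else x) by case: (ltnP x K) => ?; lia.
  move: (if x < K then _ else _) => y lty; rewrite M6v M5v ?M4v; last by move: lty => /[swap] ->.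
  by case: y lty => [|[|[|[|[|[|[|[|[|[|[|y]]]]]]]]]]].
- move=> a i lta; have : saved_at + K <= saved_at + K + 8 * i + a by lia.
  move: (_ + a) => y lty; rewrite -(M3z y lty); have {lty}: 10 < y by lia.
  move=> lty; rewrite M6v M5v ?M4v; last by move: lty => /[swap] ->.
  by case: y lty => [|[|[|[|[|[|[|[|[|[|[|y]]]]]]]]]]].
Qed.
End Prelude.

Section Whole.
Variables (K : nat) (main : cmd).

Definition main_pos := (size (prelude K)).+1.
Definition no_edges_pos := main_pos + csize main + 1.

(** Without edges the relocation address degenerates to [n], which may lie below [K], so this case
    branches off at once. Its only minimal transversal is the empty set, printed as a lone
    separator. *)
Definition program : seq instr :=
  IJZ 1 no_edges_pos :: prelude K ++ ccmd K main 0 main_pos ++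
  [:: IHALT; ICONST 0 0; IOUT 0; IHALT].

Lemma program_no_edges n : exists fin,
  exec program 4 (init_state ([::] : seq (seq 'I_n))) = Some fin /\ out fin = [:: 0].
Proof.
have at_end i : i < 3 -> nth IHALT program (no_edges_pos + i) = nth IHALT [:: ICONST 0 0;
  IOUT 0; IHALT] i.
  move=> lti; rewrite /program /no_edges_pos /main_pos.
  rewrite (_ : _ + i = (size (prelude K) + (size (ccmd K main 0 main_pos) + i.+1)).+1); last first.
    by rewrite size_ccmd; lia.
  by rewrite /= nth_cat ltnNge leq_addr /= addKn nth_cat ltnNge leq_addr /= addKn.
have p0 : nth IHALT program 0 = IJZ 1 no_edges_pos by [].
move: program no_edges_pos p0 (at_end 0 isT) (at_end 1 isT) (at_end 2 isT) => P l p0.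
rewrite addn0 addn1 addn2 => p1 p2 p3.
eexists; rewrite /= /step /= p0 /= p1 /= p2 /= p3; by [].
Qed.

Lemma program_correct n (Es : seq (seq 'I_n)) : 10 < K -> wfc K main 0 -> 0 < size Es ->
  exists (R : nat -> nat) (t : nat) (fin : state),
    let s0 := LS R (fun _ _ => 0) [::] in
    [/\ R 0 = n, R 1 = size Es, exec program t (init_state Es) = Some fin,
        t <= size (prelude K) + cost (inp Es) main s0 + 2 &
        out fin = ou (sem (inp Es) main s0)].
Proof.
move=> K11 wf Es0.
have [Hn Hm R] := prelude_correct K11 Es0; set M := foldl _ _ _ in Hn Hm R.
have [le1 le2] := lim_saved_at K11 Es0.
have inp0 x : 2 + 3 * size Es <= x -> inp Es x = 0.
  by move=> lex; rewrite /inp /input_mem; do ![rewrite (_ : (_ == _) = false);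
    last by lia | rewrite (_ : (_ < _) = false); last by lia].
have ca : code_at program 0 program by move=> i _.
have [c0 /code_at_cat[c1 /code_at_cat[c2 c3]]] := code_at_cons ca.
rewrite add1n -/main_pos in c2 c3; rewrite size_ccmd in c3.
have r0 := reach_jz (input_mem Es) [::] c0.
rewrite [input_mem Es 1]/= (_ : (size Es == 0) = false) in r0; last by lia.
have r1 := reach_straight (input_mem Es) [::] c1 (straight_prelude K).
rewrite add1n -/main_pos -/M in r1.
have leLB : 2 + 3 * size Es <= saved_at K Es + K by lia.
have K8 : 8 < K by lia.
have [M2 [r2 _ R2]] := ccmd_correct le2 (leqnn _) leLB inp0 K8 c2 wf R.
have [t let_ run_] := reach_trans r0 (reach_trans r1 r2).
exists (fun r => M (usr r)), t.+1; eexists; split=> //.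
- apply: run_exec run_ _; rewrite /step [pc _]/=.
  by have := c3 0 isT; rewrite addn0 => ->.
- by rewrite addn2 !ltnS; rewrite /init_state in let_ *; lia.
- by [].
Qed.
End Whole.

(** * The enumeration program *)

Section Frame.
Variable inp : nat -> nat.

Fixpoint regs_written c : seq nat :=
  match c with
  | Skip | Put _ _ _ | Out _ => [::]
  | Asg r _ => [:: r]
  | Seq c1 c2 => regs_written c1 ++ regs_written c2
  | When _ c | Loop _ c => regs_written c
  end.

Fixpoint arrays_written c : seq nat :=
  match c with
  | Skip | Asg _ _ | Out _ => [::]
  | Put a _ _ => [:: a]
  | Seq c1 c2 => arrays_written c1 ++ arrays_written c2
  | When _ c | Loop _ c => arrays_written c
  end.

Fixpoint silent c : bool :=
  match c with
  | Skip | Asg _ _ | Put _ _ _ => true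
  | Out _ => false
  | Seq c1 c2 => silent c1 && silent c2
  | When _ c | Loop _ c => silent c
  end.

Lemma iter_inv (P : nat -> lst -> Prop) f n s :
  P 0 s -> (forall k s', k < n -> P k s' -> P k.+1 (f s')) -> P n (iter n f s).
Proof.
move=> P0 PS; elim: n PS => // n IH PS; rewrite iterS; apply: (PS) => //.
by apply: IH => k s' lt; apply: PS; rewrite ltnS ltnW.
Qed.

Lemma frame_rg c s r : r \notin regs_written c -> rg (sem inp c s) r = rg s r.
Proof.
elim: c s => //= [r' e|c1 IH1 c2 IH2|e c IH|e c IH] s.
- by rewrite inE /upd => /negbTE->.
- by rewrite mem_cat negb_or => /andP[n1 n2]; rewrite IH2 ?IH1.
- by case: eqP => // _; apply: IH.
- by move=> nr; apply: (@iter_inv (fun _ s' => rg s' r = rg s r)) => // k s' _ <-; apply: IH.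
Qed.

Lemma frame_hp c s a : a \notin arrays_written c -> hp (sem inp c s) a = hp s a.
Proof.
elim: c s => //= [a' i e|c1 IH1 c2 IH2|e c IH|e c IH] s.
- by rewrite inE /updh => /negbTE->.
- by rewrite mem_cat negb_or => /andP[n1 n2]; rewrite IH2 ?IH1.
- by case: eqP => // _; apply: IH.
- by move=> nr; apply: (@iter_inv (fun _ s' => hp s' a = hp s a)) => // k s' _ <-; apply: IH.
Qed.

Lemma frame_ou c s : silent c -> ou (sem inp c s) = ou s.
Proof.
elim: c s => //= [c1 IH1 c2 IH2|e c IH|e c IH] s.
- by move=> /andP[n1 n2]; rewrite IH2 ?IH1.
- by case: eqP => // _; apply: IH.
- by move=> nr; apply: (@iter_inv (fun _ s' => ou s' = ou s)) => // k s' _ <-; apply: IH.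
Qed.

Lemma sem_seq c1 c2 s : sem inp (Seq c1 c2) s = sem inp c2 (sem inp c1 s). Proof. by []. Qed.

Lemma sem_when e c s : sem inp (When e c) s = if eval inp s e == 0 then s else sem inp c s.
Proof. by []. Qed.

Lemma sem_loop e c s : sem inp (Loop e c) s = iter (eval inp s e) (sem inp c) s.
Proof. by []. Qed.
End Frame.

Notation "c1 ;; c2" := (Seq c1 c2) (at level 61, right associativity).

(* rn, rM: numbers of vertices and edges; rm, rN: number of blocks and of vertices in
   them; rQ: number of sequences of rows. *)
Notation rn := 0 (only parsing).
Notation rM := 1 (only parsing).
Notation rN := 2 (only parsing).
Notation rm := 3 (only parsing).
Notation rQ := 4 (only parsing).
Notation rx := 5 (only parsing).
Notation rxx := 6 (only parsing).
Notation rv := 7 (only parsing).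
Notation rrow := 8 (only parsing).
Notation rt := 9 (only parsing).
Notation ry := 10 (only parsing).
Notation rres := 11 (only parsing).
Notation rok := 12 (only parsing).
Notation rcode := 13 (only parsing).
Notation rsv := 14 (only parsing).
Notation rq := 15 (only parsing).
Notation rr := 16 (only parsing).
(* aT: the table of rows; aDIV, aMOD: division by the number of rows; aS: the current
   set of vertices; aMARK: the codes of the printed sets. *)
Notation aT := 0 (only parsing).
Notation aDIV := 1 (only parsing).
Notation aMOD := 2 (only parsing).
Notation aS := 3 (only parsing).
Notation aMARK := 4 (only parsing).

Definition incr r k := Asg r (Plus (Reg r) (Const k)).

Definition at_slot j := Get aS (Inp (Plus (Reg ry) (Const j))).

Definition find_body :=
  When (Minus (Const 1) (Plus (Plus (at_slot 1) (at_slot 2)) (at_slot 3))) (Asg rres (Reg ry)) ;;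
  incr ry 3.

Definition find := Asg rres (Const 0) ;; Asg ry (Const 1) ;; Loop (Reg rM) find_body.

Definition check_body :=
  incr rv 1 ;; Asg rsv (Get aS (Reg rv)) ;;
  When (Reg rsv) (
    Put aS (Reg rv) (Const 0) ;; find ;; When (Minus (Const 1) (Reg rres)) (Asg rok (Const 0)) ;;
    Put aS (Reg rv) (Reg rsv)).

Definition check :=
  Asg rok (Const 1) ;; find ;; When (Reg rres) (Asg rok (Const 0)) ;; Asg rv (Const 0) ;;
  Loop (Reg rN) check_body.

(** The nested truncated subtraction turns an arbitrary nonzero mark into the bit 1. *)
Definition encode_body :=
  incr rv 1 ;;
  Asg rcode (Plus (Plus (Reg rcode) (Reg rcode))
                  (Minus (Const 1) (Minus (Const 1) (Get aS (Reg rv))))).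

Definition encode := Asg rcode (Const 0) ;; Asg rv (Const 0) ;; Loop (Reg rN) encode_body.

Definition print_body := incr rv 1 ;; When (Get aS (Reg rv)) (Out (Reg rv)).

Definition print := Asg rv (Const 0) ;; Loop (Reg rN) print_body ;; Out (Const 0).

(* A candidate is remembered by marking the cell whose address is its binary code. *)
Definition emit :=
  encode ;;
  When (Reg rok) (
    When (Minus (Const 1) (Get aMARK (Reg rcode))) (
      Put aMARK (Reg rcode) (Const 1) ;; print)).

Arguments find_body : simpl never.
Arguments check_body : simpl never.
Arguments encode_body : simpl never.
Arguments print_body : simpl never.
Arguments find : simpl never.
Arguments check : simpl never.
Arguments encode : simpl never.
Arguments print : simpl never.
Arguments emit : simpl never.

(** * Specifications of the search, the minimality test and the printing *)

Section Specs.
Variable inp : nat -> nat.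
Local Notation run := (sem inp).

Definition unhit (A : nat -> nat) k :=
  A (inp (3 * k + 2)) + A (inp (3 * k + 3)) + A (inp (3 * k + 4)) == 0.

(* The value is 0 if all of the first k edges are hit, and otherwise the
   address of the last unhit edge, minus 1. *)
Fixpoint last_unhit (A : nat -> nat) k :=
  if k is k'.+1 then if unhit A k' then 3 * k' + 1 else last_unhit A k' else 0.

Lemma eq_last_unhit A A' k : A =1 A' -> last_unhit A k = last_unhit A' k.
Proof. by move=> e; elim: k => //= k ->; rewrite /unhit !e. Qed.

Lemma find_spec s : rg (run find s) rres = last_unhit (hp s aS) (rg s rM).
Proof.
pose Inv k s' := [/\ rg s' rres = last_unhit (hp s aS) k, rg s' ry = 3 * k + 1 &
  hp s' aS = hp s aS].
rewrite /find /=; set s1 := LS _ _ _.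
suff [] : Inv (rg s rM) (iter (rg s rM) (run find_body) s1) by [].
apply: iter_inv => [|k s' ltk [h1 h2 h3]]; first by split.
split; last 1 first.
- by rewrite frame_hp.
- have E j : 3 * k + 1 + j = 3 * k + j.+1 by lia.
  rewrite /find_body /= h2 h3 !E /unhit subn_eq0 lt0n; case: eqP => _ //=.
- by rewrite /find_body /=; case: eqP => _; rewrite /upd /= h2; lia.
Qed.

Definition minimal_hit (A : nat -> nat) M N :=
  (last_unhit A M == 0) &&
  all (fun v => (A v != 0) ==> (last_unhit (upd A v 0) M != 0)) (iota 1 N).

Lemma iotaSr m k : iota m k.+1 = rcons (iota m k) (m + k).
Proof. by have := iotaD m k 1; rewrite addn1 cats1. Qed.

Lemma minimal_hitS A M k :
  minimal_hit A M k.+1 = minimal_hit A M k && ((A k.+1 != 0) ==> (last_unhit (upd A k.+1 0) M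
    != 0)).
Proof.
by rewrite /minimal_hit iotaSr all_rcons -andbA [all _ _ && _]andbC.
Qed.

(** The array is recovered only pointwise: each marked vertex is unmarked for its test and then
    written back, which gives another function with the same values. *)
Lemma check_spec s :
  (rg (run check s) rok != 0) = minimal_hit (hp s aS) (rg s rM) (rg s rN) /\
  hp (run check s) aS =1 hp s aS.
Proof.
set A := hp s aS; set M := rg s rM.
pose Inv k s' := [/\ (rg s' rok != 0) = minimal_hit A M k, hp s' aS =1 A, rg s' rv = k &
  rg s' rM = M].
rewrite /check 4!sem_seq; set s1 := run find _; set s2 := run (When _ _) _.
have N2 : rg s2 rN = rg s rN by rewrite /s2 frame_rg // /s1 frame_rg.
have M2 : rg s2 rM = M by rewrite /s2 frame_rg // /s1 frame_rg.
have h2 : hp s2 aS = A by rewrite /s2 frame_hp // /s1 frame_hp.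
have ok2 : (rg s2 rok != 0) = (last_unhit A M == 0).
  have r1 : rg s1 rres = last_unhit A M by rewrite /s1 find_spec.
  by rewrite /s2 sem_when [eval _ _ _]/= r1; case: (last_unhit _ _) => //=; rewrite /s1 frame_rg.
suff [] : Inv (rg s rN) (run (Loop (Reg rN) check_body) (run (Asg rv (Const 0)) s2)) by [].
rewrite sem_loop (_ : eval _ _ _ = rg s rN) //; apply: iter_inv => [|k s' ltk [ok hA v Mk]].
  by split=> //=; rewrite ?h2 // ok2 /minimal_hit andbT.
rewrite /Inv minimal_hitS -ok /check_body 2!sem_seq sem_when; set s3 := run _ (run _ s').
have v3 : rg s3 rv = k.+1 by rewrite /s3 /= /upd /= v addn1.
have sv3 : rg s3 rsv = A k.+1 by rewrite /s3 /= /upd /= v addn1 hA.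
have h3 : hp s3 aS =1 A by [].
have M3 : rg s3 rM = M by rewrite /s3 frame_rg ?frame_rg.
have ok3 : rg s3 rok = rg s' rok by rewrite /s3 frame_rg ?frame_rg.
rewrite [eval _ _ _]sv3 -ok3; move: s3 v3 sv3 h3 M3 ok3 => s3 v3 sv3 h3 M3 ok3.
case: (eqVneq (A k.+1) 0) => [e|ne]; rewrite ?implyTb; first by rewrite andbT; split.
rewrite 3!sem_seq; set s4 := run (Put _ _ _) s3.
have h4 : hp s4 aS =1 upd A k.+1 0 by move=> u; rewrite /s4 /= /updh /= /upd /= v3 h3.
set s5 := run find s4; set s6 := run (When _ _) s5.
have h6 : hp s6 aS = hp s4 aS by rewrite /s6 frame_hp // /s5 frame_hp.
have v6 : rg s6 rv = k.+1 by rewrite /s6 frame_rg // /s5 frame_rg.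
have sv6 : rg s6 rsv = A k.+1 by rewrite /s6 frame_rg // /s5 frame_rg.
have M6 : rg s6 rM = M by rewrite /s6 frame_rg // /s5 frame_rg.
split=> //.
  have r5 : rg s5 rres = last_unhit (upd A k.+1 0) M by rewrite /s5 find_spec (eq_last_unhit _
    h4) [rg s4 rM]M3.
  have ok5 : rg s5 rok = rg s3 rok by rewrite /s5 frame_rg.
  rewrite [LHS]/= /s6 sem_when [eval _ _ _]/= r5; case: (last_unhit _ _) => [|w] /=;
    first by rewrite andbF.
  by rewrite ok5 andbT.
move=> u; rewrite /= /updh /= /upd /= v6 sv6 h6; case: eqP => [-> //|/eqP/negbTE ne'].
by rewrite h4 /upd ne'.
Qed.


Definition code (A : nat -> nat) N := foldl (fun c v => c.*2 + (A v != 0)) 0 (iota 1 N).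

Definition listing (A : nat -> nat) N := [seq v <- iota 1 N | A v != 0].

Lemma encode_spec s : rg (run encode s) rcode = code (hp s aS) (rg s rN).
Proof.
pose Inv k s' := [/\ rg s' rcode = code (hp s aS) k, rg s' rv = k & hp s' aS = hp s aS].
rewrite /encode 2!sem_seq; set s1 := run _ (run _ s).
suff [] : Inv (rg s rN) (run (Loop (Reg rN) encode_body) s1) by [].
rewrite sem_loop (_ : eval _ _ _ = rg s rN) //; apply: iter_inv => [|k s' ltk [h1 h2 h3]];
  first by split.
rewrite /Inv /code iotaSr foldl_rcons -/(code _ _) -h1; split=> //.
  rewrite /encode_body /= /upd /= h2 h3 addn1 addnn; congr (_ + _); by case: (hp _ _ _) => [|[|w]].
by rewrite /encode_body /= /upd /= h2 addn1.
Qed.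

Lemma print_spec s : ou (run print s) = ou s ++ rcons (listing (hp s aS) (rg s rN)) 0.
Proof.
pose Inv k s' := [/\ ou s' = ou s ++ listing (hp s aS) k, rg s' rv = k & hp s' = hp s].
rewrite /print 2!sem_seq; set s1 := run _ s.
suff [E _ _] : Inv (rg s rN) (run (Loop (Reg rN) print_body) s1).
  by rewrite -rcons_cat -E.
rewrite sem_loop (_ : eval _ _ _ = rg s rN) //; apply: iter_inv => [|k s' ltk [h1 h2 h3]].
  by rewrite /Inv /listing /= cats0.
rewrite /Inv /listing iotaSr filter_rcons -/(listing _ _) /print_body /= /upd /= h2 h3 addn1.
by case: eqP => _ /=; rewrite h1 ?rcons_cat.
Qed.

Lemma emit_spec s (A := hp s aS) (N := rg s rN) (s' := run emit s) :
  if (rg s rok != 0) && (hp s aMARK (code A N) == 0)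
  then hp s' aMARK = upd (hp s aMARK) (code A N) 1 /\ ou s' = ou s ++ rcons (listing A N) 0
  else hp s' aMARK = hp s aMARK /\ ou s' = ou s.
Proof.
rewrite /s' /emit sem_seq sem_when; set s1 := run encode s.
have ok1 : rg s1 rok = rg s rok by rewrite /s1 frame_rg.
have N1 : rg s1 rN = rg s rN by rewrite /s1 frame_rg.
have c1 : rg s1 rcode = code A N by rewrite /s1 encode_spec.
have h1 : hp s1 aMARK = hp s aMARK by rewrite /s1 frame_hp.
have hS : hp s1 aS = A by rewrite /s1 frame_hp.
have o1 : ou s1 = ou s by rewrite /s1 frame_ou.
move: s1 ok1 N1 c1 h1 hS o1 => s1 ok1 N1 c1 h1 hS o1.
rewrite [eval _ _ _]ok1; case: (rg s rok == 0); first by split.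
rewrite andTb sem_when [eval _ _ _]/= c1 h1; case: (hp s aMARK (code A N)) => [|w]; last by split.
rewrite [0 == 0]/= [_ == 0]/=.
rewrite sem_seq; set s2 := run _ s1.
split; first by rewrite frame_hp // /s2 /= /updh /= c1 h1.
by rewrite print_spec /s2 /= /updh /= o1 hS N1.
Qed.

End Specs.

Section Program.
Variables (b W : nat).

Definition fill_body := incr rv 1 ;; Put aS (Reg rv) (Get aT (Reg rrow)) ;; incr rrow 1.

Definition fill_block :=
  Asg rrow (Get aMOD (Reg rxx)) ;; Asg rxx (Get aDIV (Reg rxx)) ;; Loop (Const b) fill_body.

Definition fill := Asg rxx (Reg rx) ;; Asg rv (Const 0) ;; Loop (Reg rm) fill_block.

(* Address 0 of the vertex array stands for the empty slots of small edges: it is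
   reset, so that a choice of an empty slot has no effect. *)
Definition trit_body :=
  Asg rt (Get aT (Reg rrow)) ;; incr rrow 1 ;;
  When (Reg rt) (
    find ;;
    When (Reg rres) (Put aS (Inp (Plus (Reg rres) (Reg rt))) (Const 1) ;;
      Put aS (Const 0) (Const 0))).

Definition trit_block :=
  Asg rrow (Plus (Get aMOD (Reg rxx)) (Const b)) ;; Asg rxx (Get aDIV (Reg rxx)) ;;
  Loop (Const b) trit_body.

Definition branch := Asg rxx (Reg rx) ;; Loop (Reg rm) trit_block.

Definition iteration := fill ;; branch ;; check ;; emit ;; incr rx 1.
End Program.

Arguments fill_body : simpl never.
Arguments fill_block : simpl never.
Arguments fill : simpl never.
Arguments trit_body : simpl never.
Arguments trit_block : simpl never.
Arguments branch : simpl never.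
Arguments iteration : simpl never.

Section Specs.
Variables (inp : nat -> nat) (b W Q : nat) (T : nat -> nat).
Hypotheses (b_gt0 : 0 < b) (W_gt0 : 0 < W).
Local Notation run := (sem inp).

Record tables (s : lst) : Prop := Tables {
  tab_T : forall i, hp s aT i = T i;
  tab_DIV : forall y, y < Q -> hp s aDIV y = y %/ W;
  tab_MOD : forall y, y < Q -> hp s aMOD y = y %% W * (2 * b) }.

Lemma tables_frame c s : aT \notin arrays_written c -> aDIV \notin arrays_written c ->
  aMOD \notin arrays_written c -> tables s -> tables (run c s).
Proof. by move=> n1 n2 n3 [t1 t2 t3]; split; rewrite frame_hp. Qed.

(** A number below W^m encodes a sequence of m rows, least significant digit first. *)
Definition digit x i := (x %/ W ^ i) %% W.

Definition start x u := T (digit x (u.-1 %/ b) * (2 * b) + u.-1 %% b).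

Lemma fill_spec s x m : rg s rx = x -> x < Q -> rg s rm = m -> tables s ->
  forall u, hp (run (fill b) s) aS u = if 0 < u <= m * b then start x u else hp s aS u.
Proof.
move=> sx ltx sm tabs.
pose Inv k s' := [/\ rg s' rxx = x %/ W ^ k, rg s' rv = k * b, tables s' &
  forall u, hp s' aS u = if 0 < u <= k * b then start x u else hp s aS u].
suff [] : Inv m (run (fill b) s) by [].
rewrite /fill 2!sem_seq; set s1 := run _ (run _ s).
rewrite sem_loop (_ : eval _ _ _ = m) //; apply: iter_inv => [|k s' ltk [h1 h2 h3 h4]].
  by split; rewrite /s1 ?expn0 ?divn1 /= /upd //=; [case: tabs | case=> [|u];
    rewrite // leqn0 andbF].
rewrite /fill_block 2!sem_seq; set s2 := run _ (run _ s').
set r0 := digit x k * (2 * b).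
have ltxQ : x %/ W ^ k < Q by rewrite (leq_ltn_trans (leq_div _ _)).
pose Inv2 p s'' := [/\ rg s'' rxx = x %/ W ^ k.+1, rg s'' rv = k * b + p, rg s'' rrow =
  r0 + p, tables s'' &
  forall u, hp s'' aS u = if k * b < u <= k * b + p then T (r0 + (u.-1 - k * b)) else hp s' aS u].
suff [i1 i2 _ i4 i5] : Inv2 b (run (Loop (Const b) fill_body) s2).
  split=> // [|u]; first by rewrite i2 mulSn addnC.
  rewrite i5 h4 mulSn [b + _]addnC; case: (ltnP (k * b) u) => [ltu|leu] /=; last first.
    by rewrite (leq_trans leu) ?leq_addr.
  have u_gt0 : 0 < u by rewrite (leq_ltn_trans _ ltu).
  rewrite u_gt0 /=; case: (leqP u (k * b + b)) => // leu.
  rewrite /start /r0; have -> : u.-1 = k * b + (u.-1 - k * b) by rewrite subnKC // -ltnS prednK.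
  have lt : u.-1 - k * b < b by move: ltu leu; rewrite addnC; move: (k * b) => kb; lia.
  by rewrite addKn divnMDl // modnMDl divn_small // modn_small // addn0.
rewrite sem_loop (_ : eval _ _ _ = b) //; apply: iter_inv => [|p s'' ltp [i1 i2 i3 i4 i5]].
  split; rewrite /s2 /= /upd /= ?h1 ?addn0 ?(tab_DIV h3) ?(tab_MOD h3) //.
  - by rewrite expnSr divnMA.
  - by case: h3.
  - by move=> u; case: (ltngtP (k * b) u).
split; rewrite /fill_body /= /upd /= ?i2 ?i3 ?addnS ?addn0 //.
- by case: i4.
move=> u; rewrite /updh /= (tab_T i4) /upd; case: eqP => [->|ne].
  by rewrite ltnS leq_addr leqnn /= addKn.
by rewrite i5; congr (if _ then _ else _); lia.
Qed.

Definition add_trit M (A : nat -> nat) t : nat -> nat :=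
  if (t == 0) || (last_unhit inp A M == 0) then A
  else upd (upd A (inp (last_unhit inp A M + t)) 1) 0 0.

Fixpoint process M (A : nat -> nat) (dg : nat -> nat) k :=
  if k is k'.+1
  then foldl (add_trit M) (process M A dg k') [seq T (dg k' * (2 * b) + b + p) | p <- iota 0 b]
  else A.

Lemma branch_spec s x m : rg s rx = x -> x < Q -> rg s rm = m -> tables s ->
  hp (run (branch b) s) aS = process (rg s rM) (hp s aS) (digit x) m.
Proof.
move=> sx ltx sm tabs; set M := rg s rM.
pose Inv k s' := [/\ rg s' rxx = x %/ W ^ k, rg s' rM = M, tables s' &
  hp s' aS = process M (hp s aS) (digit x) k].
suff [] : Inv m (run (branch b) s) by [].
rewrite /branch sem_seq; set s1 := run _ s.
rewrite sem_loop (_ : eval _ _ _ = m) //; apply: iter_inv => [|k s' ltk [h1 h2 h3 h4]].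
  by split; rewrite /s1 ?expn0 ?divn1 /= /upd //=; case: tabs.
rewrite /trit_block 2!sem_seq; set s2 := run _ (run _ s').
set r0 := digit x k * (2 * b) + b.
have ltxQ : x %/ W ^ k < Q by rewrite (leq_ltn_trans (leq_div _ _)).
pose Inv2 p s'' := [/\ rg s'' rxx = x %/ W ^ k.+1, rg s'' rM = M, rg s'' rrow = r0 + p, tables s'' &
  hp s'' aS = foldl (add_trit M) (hp s' aS) [seq T (r0 + p) | p <- iota 0 p]].
suff [i1 i2 _ i4 i5] : Inv2 b (run (Loop (Const b) trit_body) s2) by split; rewrite // i5 h4.
rewrite sem_loop (_ : eval _ _ _ = b) //; apply: iter_inv => [|p s'' ltp [i1 i2 i3 i4 i5]].
  split; rewrite /s2 /= /upd /= ?h1 ?h2 ?addn0 ?(tab_DIV h3) ?(tab_MOD h3) //.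
  - by rewrite expnSr divnMA.
  - by case: h3.
rewrite /Inv2 iotaSr map_rcons foldl_rcons -i5 add0n.
have i4' : tables (run trit_body s'') by apply: tables_frame.
rewrite frame_rg // i1 frame_rg // i2; split=> //; rewrite /trit_body 2!sem_seq;
  set s3 := run _ (run _ s'').
  by rewrite frame_rg // /s3 /= /upd /= i3 addn1 addnS.
have t3 : rg s3 rt = T (r0 + p) by rewrite /s3 /= /upd /= i3 (tab_T i4).
have M3 : rg s3 rM = M by rewrite /s3 -i2 /= /upd.
have h3' : hp s3 aS = hp s'' aS by [].
move: s3 t3 M3 h3' => s3 t3 M3 h3'.
rewrite sem_when [eval _ _ _]t3 /add_trit; case: (T _ == 0); first by [].
rewrite orFb sem_seq sem_when; set s4 := run find s3.
have r4 : rg s4 rres = last_unhit inp (hp s'' aS) M by rewrite /s4 find_spec h3' M3.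
have t4 : rg s4 rt = T (r0 + p) by rewrite /s4 frame_rg.
have h4' : hp s4 aS = hp s'' aS by rewrite /s4 frame_hp.
rewrite [eval _ _ _]r4; case: eqP => // _.
by rewrite /= /updh /= r4 t4 h4'.
Qed.
End Specs.

Section Main.
Variables (b W : nat) (tab : seq nat).

(** Repeated addition replaces the multiplication by [W]. The enclosing loop makes [n + 1] rounds,
    which suffice to exceed [n] because every active round adds at least one vertex. *)
Definition dims_body :=
  When (Minus (Plus (Reg rn) (Const 1)) (Reg rN)) (
    incr rN b ;; incr rm 1 ;;
    Asg rq (Const 0) ;; Loop (Const W) (Asg rq (Plus (Reg rq) (Reg rQ))) ;; Asg rQ (Reg rq)).

Definition dims :=
  Asg rm (Const 0) ;; Asg rN (Const 0) ;; Asg rQ (Const 1) ;;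
    Loop (Plus (Reg rn) (Const 1)) dims_body.

(* Remainders are scaled by the row length 2 b, so that they point into the table. *)
Definition divtab_body :=
  Put aDIV (Reg rx) (Reg rq) ;; Put aMOD (Reg rx) (Reg rr) ;; incr rx 1 ;; incr rr (2 * b) ;;
  When (Minus (Const 1) (Minus (Const (W * (2 * b))) (Reg rr))) (Asg rr (Const 0) ;; incr rq 1).

(** Counting upwards gives each quotient and remainder in constant time, so the whole table costs no
    more than a constant per row sequence. *)
Definition divtab := Asg rx (Const 0) ;; Asg rq (Const 0) ;; Asg rr (Const 0) ;;
  Loop (Reg rQ) divtab_body.

Definition tabinit := foldr (fun i c => Put aT (Const i) (Const (nth 0 tab i)) ;;
  c) Skip (iota 0 (size tab)).

Definition main := tabinit ;; dims ;; divtab ;; Asg rx (Const 0) ;; Loop (Reg rQ) (iteration b).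
End Main.

Arguments dims_body : simpl never.
Arguments dims : simpl never.
Arguments divtab_body : simpl never.
Arguments divtab : simpl never.
Arguments tabinit : simpl never.
Arguments main : simpl never.

Section Specs.
Variables (inp : nat -> nat) (b W : nat) (tab : seq nat).
Hypotheses (b_gt0 : 0 < b) (W_gt0 : 0 < W).
Local Notation run := (sem inp).
Local Notation T := (nth 0 tab).

Lemma tabinit_regs : regs_written (tabinit tab) = [::].
Proof. by rewrite /tabinit; elim: (iota _ _) => //= i l ->. Qed.

Lemma tabinit_arrays a : a != aT -> a \notin arrays_written (tabinit tab).
Proof. by move=> na; rewrite /tabinit; elim: (iota _ _) => //= i l IH; rewrite inE negb_or na. Qed.

Lemma tabinit_silent : silent (tabinit tab).
Proof. by rewrite /tabinit; elim: (iota _ _). Qed.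

Lemma tabinit_spec s i : hp s aT i = 0 -> hp (run (tabinit tab) s) aT i = T i.
Proof.
move=> s0; suff E l s' : hp (run (foldr (fun i c => Put aT (Const i) (Const (T i)) ;;
  c) Skip l) s') aT i =
    if i \in l then T i else hp s' aT i.
  by rewrite E mem_iota /= s0; case: ltnP => // /(nth_default 0) ->.
elim: l s' => //= j l IH s'; rewrite IH /= /updh /= /upd inE; case: eqP => [->|] //.
by rewrite if_same.
Qed.

Lemma dims_spec s n : rg s rn = n -> let s' := run (dims b W) s in
  [/\ rg s' rN = rg s' rm * b, rg s' rQ = W ^ rg s' rm & n < rg s' rN <= n + b].
Proof.
move=> sn s'.
pose Inv k s' := [/\ rg s' rN = rg s' rm * b, rg s' rQ = W ^ rg s' rm, rg s' rN <= n + b,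
  (n < rg s' rN) || (rg s' rm == k) & rg s' rn = n].
suff [h1 h2 h3 h4 h5] : Inv n.+1 s'.
  split=> //; rewrite h3 andbT; case/orP: h4 => // /eqP h4.
  by rewrite h1 h4 leq_pmulr.
rewrite /s' /dims 3!sem_seq; set s1 := run _ (run _ (run _ s)).
rewrite sem_loop (_ : eval _ _ _ = n.+1); last by rewrite /s1 /= /upd /= sn addn1.
apply: iter_inv => [|k s2 ltk [h1 h2 h3 h4 h5]].
  by split; rewrite /s1 /= /upd //= orbT.
rewrite /dims_body sem_when [eval _ _ _]/= h5 subn_eq0 addn1.
case: ltnP => [ltn|len]; first by split=> //; rewrite ltn.
rewrite 4!sem_seq; set s3 := run _ (run _ (run _ s2)).
set s4 := run (Loop _ _) s3.
have N4 : rg s4 rN = rg s2 rN + b by rewrite /s4 frame_rg.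
have m4 : rg s4 rm = (rg s2 rm).+1 by rewrite /s4 frame_rg // /s3 /= /upd /= addn1.
have n4 : rg s4 rn = n by rewrite /s4 frame_rg.
have q4 : rg s4 rq = W * rg s2 rQ.
  pose Inv2 k s'' := rg s'' rq = k * rg s2 rQ /\ rg s'' rQ = rg s2 rQ.
  suff [] : Inv2 W s4 by [].
  rewrite /s4 sem_loop; apply: iter_inv => [|k' s5 _ [i1 i2]]; first by split.
  by split; rewrite /= /upd /= ?i1 ?i2 // mulSn addnC.
rewrite /Inv /= /upd /= N4 m4 n4 q4 h1 h2 expnS mulSn addnC; split=> //.
  by rewrite addnC leq_add2r -h1.
move: h4; rewrite ltnNge len /= eqSS => ->; exact: orbT.
Qed.

Lemma divtab_spec s : let s' := run (divtab b W) s in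
  forall y, y < rg s rQ -> hp s' aDIV y = y %/ W /\ hp s' aMOD y = y %% W * (2 * b).
Proof.
move=> s'.
pose Inv k s' := [/\ rg s' rx = k, rg s' rq = k %/ W, rg s' rr = k %% W * (2 * b) &
  forall y, y < k -> hp s' aDIV y = y %/ W /\ hp s' aMOD y = y %% W * (2 * b)].
suff [] : Inv (rg s rQ) s' by [].
rewrite /s' /divtab 3!sem_seq; set s1 := run _ (run _ (run _ s)).
rewrite sem_loop (_ : eval _ _ _ = rg s rQ) //.
apply: iter_inv => [|k s2 ltk [h1 h2 h3 h4]].
  by split; rewrite ?div0n ?mod0n.
rewrite /divtab_body 4!sem_seq; set s3 := run _ (run _ (run _ (run _ s2))).
have x3 : rg s3 rx = k.+1 by rewrite /s3 /= /upd /= h1 addn1.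
have q3 : rg s3 rq = k %/ W by rewrite /s3 /= /upd /= h2.
have r3 : rg s3 rr = (k %% W).+1 * (2 * b) by rewrite /s3 /= /upd /= h3 mulSn addnC.
have t3 y : y < k.+1 -> hp s3 aDIV y = y %/ W /\ hp s3 aMOD y = y %% W * (2 * b).
  move=> lty; rewrite /s3 /= /updh /= /upd /= h1 h2 h3; case: eqP => [->//|/eqP ne].
  by apply: h4; rewrite ltn_neqAle ne -ltnS.
have Wk : k.+1 = k %/ W * W + (k %% W).+1 by rewrite addnS -divn_eq.
have ltW := ltn_pmod k W_gt0.
move: s3 x3 q3 r3 t3 => s3 x3 q3 r3 t3.
rewrite sem_when [eval _ _ _]/= r3 subn_eq0 ltn_subRL addn0 ltn_mul2r muln_gt0 b_gt0 /=.
have [lt|ge] := ltnP (k %% W).+1 W.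
  split; rewrite ?x3 ?q3 ?r3 // Wk; first by rewrite divnMDl // (divn_small lt) addn0.
  by rewrite modnMDl (modn_small lt).
have {}Wk : k.+1 = (k %/ W).+1 * W by rewrite Wk mulSn addnC; congr (_ + _); apply/eqP;
  rewrite eqn_leq ltW.
split; rewrite /= /upd //= ?q3 ?Wk; first by rewrite mulnK // addn1.
by rewrite modnMl.
Qed.

Lemma eq_process M A A' dg k : A =1 A' -> process inp b T M A dg k =1 process inp b T M A' dg k.
Proof.
move=> e; elim: k => //= k IH.
elim: [seq _ | _ <- _] (process _ _ _ _ A _ _) (process _ _ _ _ A' _ _) IH => //= t l IHl B B' eB.
apply: IHl => u; rewrite /add_trit (eq_last_unhit _ _ eB); case: ifP => // _.
by rewrite /upd !eB.
Qed.

(** The array [A] left by the previous iteration matters only at address 0 and beyond the padded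
    range, as the fill rewrites everything in between; no clearing pass is run. *)
Definition outcome M m x (A : nat -> nat) :=
  process inp b T M (fun u => if 0 < u <= m * b then start b W T x u else A u) (digit W x) m.

Lemma iteration_spec Q s x m M : rg s rx = x -> x < Q -> rg s rm = m -> rg s rN = m * b ->
  rg s rM = M -> tables b W Q T s ->
  let s' := run (iteration b) s in let A := outcome M m x (hp s aS) in let N := m * b in
  [/\ [/\ rg s' rx = x.+1, rg s' rm = m, rg s' rN = m * b & rg s' rM = M],
      tables b W Q T s', hp s' aS =1 A &
      if minimal_hit inp A M N && (hp s aMARK (code A N) == 0)
      then hp s' aMARK = upd (hp s aMARK) (code A N) 1 /\ ou s' = ou s ++ rcons (listing A N) 0
      else hp s' aMARK = hp s aMARK /\ ou s' = ou s].
Proof.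
move=> sx ltx sm sN sM tabs s' A N.
rewrite /s' /iteration 4!sem_seq.
set s1 := run (fill b) s; set s2 := run (branch b) s1; set s3 := run check s2;
  set s4 := run emit s3.
have m1 : rg s1 rm = m by rewrite /s1 frame_rg.
have M1 : rg s1 rM = M by rewrite /s1 frame_rg.
have x1 : rg s1 rx = x by rewrite /s1 frame_rg.
have N1 : rg s1 rN = N by rewrite /s1 frame_rg.
have t1 : tables b W Q T s1 by apply: tables_frame.
have A2 : hp s2 aS =1 A.
  by rewrite /s2 (branch_spec inp x1 ltx m1 t1) M1; apply: eq_process;
    apply: (fill_spec inp b_gt0 W_gt0 sx ltx sm tabs).
have [ok3 S3] := check_spec inp s2; rewrite -/s3 in ok3 S3.
have M2 : rg s2 rM = M by rewrite /s2 frame_rg.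
have N2 : rg s2 rN = N by rewrite /s2 frame_rg.
have x2 : rg s2 rx = x by rewrite /s2 frame_rg.
have m2 : rg s2 rm = m by rewrite /s2 frame_rg.
have M3 : rg s3 rM = M by rewrite /s3 frame_rg.
have N3 : rg s3 rN = N by rewrite /s3 frame_rg.
have x3 : rg s3 rx = x by rewrite /s3 frame_rg.
have m3 : rg s3 rm = m by rewrite /s3 frame_rg.
have S4 : hp s4 aS = hp s3 aS by rewrite /s4 frame_hp.
have A3 : hp s3 aS =1 A by move=> u; rewrite S3 A2.
have mh : minimal_hit inp (hp s2 aS) M N = minimal_hit inp A M N.
  rewrite /minimal_hit (eq_last_unhit _ _ A2); congr (_ && _).
  apply: eq_all => v; rewrite A2; congr (_ ==> (_ != _)).
  by apply: eq_last_unhit => u; rewrite /upd A2.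
have codeE : code (hp s3 aS) N = code A N.
  suff E l c : foldl (fun c v => c.*2 + (hp s3 aS v != 0)) c l = foldl (fun c v =>
    c.*2 + (A v != 0)) c l by apply: E.
  by elim: l c => //= v l IH c; rewrite A3 IH.
have listE : listing (hp s3 aS) N = listing A N by apply: eq_filter => v; rewrite A3.
have K3 : hp s3 aMARK = hp s aMARK by rewrite /s3 frame_hp // /s2 frame_hp // /s1 frame_hp.
have o3 : ou s3 = ou s by rewrite /s3 frame_ou // /s2 frame_ou // /s1 frame_ou.
have x4 : rg s4 rx = x by rewrite /s4 frame_rg.
have m4 : rg s4 rm = m by rewrite /s4 frame_rg.
have N4 : rg s4 rN = N by rewrite /s4 frame_rg.
have M4 : rg s4 rM = M by rewrite /s4 frame_rg.
have t4 : tables b W Q T s4.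
  by apply: tables_frame => //; apply: tables_frame => //; apply: tables_frame.
have := emit_spec inp s3; lazy zeta; rewrite -/s4 N3 ok3 M2 N2 mh codeE listE K3 o3.
move: s4 x4 m4 N4 M4 t4 S4 => s4 x4 m4 N4 M4 t4 S4 E4.
split; [|exact: tables_frame| |exact: E4]; first by split; rewrite /= /upd /= ?x4 ?addn1.
by move=> u; rewrite [hp _ _]/= S4 A3.
Qed.
End Specs.

(** * Vertex arrays and transversals *)

Section Edges.
Variables (n : nat) (Es : seq (seq 'I_n)).
Local Notation inp := (inp Es).
Local Notation edge k := (nth [::] Es k).
Local Notation M := (size Es).

Lemma inp_slot k j : k < M -> j < 3 -> inp (3 * k + (2 + j)) = slot (edge k) j.
Proof.
move=> ltk ltj; rewrite /inp /input_mem.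
rewrite (_ : (_ < 2) = false); last by lia.
rewrite (_ : (_ == 0) = false); last by lia.
rewrite (_ : (_ == 1) = false); last by lia.
rewrite (_ : (_ < _) = true); last by lia.
have -> : 3 * k + (2 + j) - 2 = k * 3 + j by lia.
by rewrite divnMDl // modnMDl divn_small // modn_small // addn0.
Qed.

Lemma slot_eq (e : seq 'I_n) j u : slot e j = u.+1 -> exists2 v : 'I_n, v \in e & u = v.
Proof.
rewrite /slot; have [ltj|] := ltnP j (size e); last by move=> le; rewrite nth_default ?size_map.
case: e ltj => // v0 e ltj; rewrite (nth_map v0) // => -[<-].
by exists (nth v0 (v0 :: e) j); rewrite ?mem_nth.
Qed.

Lemma slot_mem (e : seq 'I_n) (v : 'I_n) : size e <= 3 -> v \in e -> exists2 j, j < 3 &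
  slot e j = v.+1.
Proof.
move=> le3 ve; exists (index v e); first by rewrite (leq_trans _ le3) // index_mem.
by rewrite /slot (nth_map v) ?index_mem // nth_index.
Qed.

Lemma inp_le y : 2 <= y -> inp y <= n.
Proof.
move=> ge2; rewrite /inp /input_mem ltnNge ge2 /=.
case: eqP => // _; case: eqP => [|_]; first by lia.
case: ifP => // _; case E : (slot _ _) => [//|u].
by have [v _ ->] := slot_eq E.
Qed.

Hypothesis rank3 : all (fun e => uniq e && (size e <= 3)) Es.

Lemma unhitP A k : A 0 = 0 -> k < M ->
  reflect (forall v : 'I_n, v \in edge k -> A v.+1 = 0) (unhit inp A k).
Proof.
move=> A0 ltk; have /andP[_ le3] := allP rank3 _ (mem_nth [::] ltk).
have E j : j < 3 -> inp (3 * k + (2 + j)) = slot (edge k) j by apply: inp_slot.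
rewrite /unhit (E 0) // (E 1) // (E 2) // !addn_eq0 -andbA.
apply: (iffP and3P) => [[/eqP h0 /eqP h1 /eqP h2] v /(slot_mem le3)[[|[|[|j]]]] // _ <- //|H].
have S j : A (slot (edge k) j) == 0.
  case Es_ : (slot _ _) => [|u]; first by rewrite A0.
  by have [v ve ->] := slot_eq Es_; rewrite H.
by split.
Qed.

Lemma last_unhit_spec A m :
  (last_unhit inp A m = 0 /\ forall k, k < m -> ~~ unhit inp A k) \/
  exists k, [/\ k < m, unhit inp A k & last_unhit inp A m = 3 * k + 1].
Proof.
elim: m => [|m [[e H]|[k [ltk un e]]]] /=; first by left.
  case un : (unhit inp A m); first by right; exists m.
  left; split=> // k; rewrite ltnS leq_eqVlt => /orP[/eqP->|/H //]; exact: negbT.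
case un' : (unhit inp A m); first by right; exists m.
by right; exists k; rewrite ltnS ltnW.
Qed.

Definition support (A : nat -> nat) : {set 'I_n} := [set v : 'I_n | A v.+1 != 0].

Lemma in_edge_set k : k < M -> [set x in edge k] \in edge_set Es.
Proof. by move=> ltk; rewrite inE; apply: map_f; apply: mem_nth. Qed.

Lemma transversal_support A : A 0 = 0 -> Defs.transversal (edge_set Es) (support A) =
  (last_unhit inp A M == 0).
Proof.
move=> A0; have [[-> H]|[k [ltk un ->]]] := last_unhit_spec A M.
  apply/forall_inP => e; rewrite inE => /mapP[s /(nthP [::])[k ltk <-] ->].
  have := H k ltk; case: (unhitP A0 ltk) => // nH _.
  apply: contraT => /existsPn none; case: nH => v ve; have := none v.
  by rewrite !inE ve /= negbK => /eqP.
rewrite addn1; apply/negbTE; apply: contraL un => /forall_inP /(_ _ (in_edge_set ltk)) /existsP[v].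
by rewrite !inE => /andP[ve Av]; apply/negP => /(unhitP A0 ltk) /(_ v ve) E; rewrite E in Av.
Qed.

Lemma transversalS (E : {set {set 'I_n}}) (S S' : {set 'I_n}) :
  S \subset S' -> Defs.transversal E S -> Defs.transversal E S'.
Proof.
move=> /subsetP sSS /forall_inP tS; apply/forall_inP => e /tS /existsP[x /andP[xe xS]].
by apply/existsP; exists x; rewrite xe sSS.
Qed.

Lemma support_upd A (v : 'I_n) : support (upd A v.+1 0) = support A :\ v.
Proof. by apply/setP => w; rewrite !inE /upd eqSS val_eqE; case: (w == v). Qed.

Lemma support_upd_big A u : n < u -> support (upd A u 0) = support A.
Proof. by move=> ltu; apply/setP => w; rewrite !inE /upd; case: (_ =P u) => // e;
  have := ltn_ord w; lia. Qed.

(** Supersets of transversals are transversals, so a proper subset may be enlarged until it misses a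
    single vertex. This is the form the program tests. *)
Lemma minimal_transversalE (E : {set {set 'I_n}}) (S : {set 'I_n}) :
  minimal_transversal E S = Defs.transversal E S && [forall v in S, ~~ Defs.transversal E (S :\ v)].
Proof.
rewrite /minimal_transversal; case tS : (Defs.transversal E S) => //=.
apply/forallP/forall_inP => [H v vS|H S'].
  by apply: (implyP (H _)); rewrite properD1.
apply/implyP => /properP[sS' [v vS vS']]; apply: contra (H v vS); apply: transversalS.
by apply/subsetP => w wS'; rewrite !inE (subsetP sS') // andbT; apply: contraNneq vS' => <-.
Qed.

(** The test runs over padding vertices too. Unmarking one leaves the support unchanged and hence
    still a transversal, so a marked padding vertex makes the test fail. *)
Lemma minimal_hitP A N : A 0 = 0 -> n <= N ->
  reflect (minimal_transversal (edge_set Es) (support A) /\ forall u, n < u <= N -> A u = 0)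
          (minimal_hit inp A M N).
Proof.
move=> A0 lenN; rewrite minimal_transversalE -/(support A) (transversal_support A0).
have A0' v : (upd A v.+1 0) 0 = 0 by [].
apply: (iffP andP) => [[t0 /allP H]|[/andP[t0 /forall_inP H] big]]; split=> //.
- rewrite t0; apply/forall_inP => v; rewrite inE => Av; rewrite -support_upd transversal_support //.
  apply: (implyP (H _ _)) => //; rewrite mem_iota /= add1n ltnS (leq_trans _ lenN) //.
- case=> // u /andP[ltu leu]; apply/eqP; apply: contraT => Au.
  have uN : u.+1 \in iota 1 N by rewrite mem_iota add1n.
  have := implyP (H _ uN) Au.
  by rewrite -transversal_support // support_upd_big // transversal_support // t0.
apply/allP => -[|u]; rewrite mem_iota // add1n ltnS => /andP[_ leu]; apply/implyP => Au.
have ltu : u < n by rewrite ltnNge; apply: contra Au => leu'; apply/eqP/big; rewrite ltnS leu'.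
by have := H (Ordinal ltu); rewrite inE -support_upd transversal_support //= => /(_ Au).
Qed.

End Edges.

(** * Completeness *)

Lemma nth_flatten_rows L (rows : seq (seq nat)) j p :
  all (fun r => size r == L) rows -> j < size rows -> p < L ->
  nth 0 (flatten rows) (j * L + p) = nth 0 (nth [::] rows j) p.
Proof.
elim: rows j => // r rows IH [|j] /= /andP[/eqP szr szs] ltj ltp.
  by rewrite nth_cat szr ltp.
by rewrite nth_cat szr mulSn -addnA ltnNge leq_addr /= addKn IH.
Qed.

Lemma exists_digits W (js : seq nat) : all (fun j => j < W) js ->
  exists2 x, x < W ^ size js & forall i, i < size js -> digit W x i = nth 0 js i.
Proof.
elim: js => [|j js IH] /=; first by exists 0.
move=> /andP[ltj /IH[x ltx Hx]]; exists (x * W + j).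
  by rewrite expnSr; have := leq_mul ltx (leqnn W); rewrite mulSn; lia.
have W0 : 0 < W by rewrite (leq_ltn_trans _ ltj).
case=> [|i] lti; rewrite /digit; first by rewrite expn0 divn1 modnMDl modn_small.
by rewrite expnS divnMA divnMDl // (divn_small ltj) addn0 -/(digit W x i) Hx.
Qed.

Section Completeness.
Variables (n : nat) (Es : seq (seq 'I_n)).
Hypothesis rank3 : all (fun e => uniq e && (size e <= 3)) Es.
Local Notation inp := (inp Es).
Local Notation M := (size Es).
Variables (b : nat) (rows : seq (seq nat)) (X : pred nat -> pred nat).
Hypotheses (b_gt0 : 0 < b) (szrows : all (fun r => size r == 2 * b) rows).
Hypothesis rowsP : forall s, subpred (X s) s /\
  forall ts, size ts = count (predD s (X s)) (iota 0 b) ->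
        all is_trit ts -> row b (X s) ts \in rows.
Local Notation W := (size rows).
Local Notation T := (nth 0 (flatten rows)).
Variable m : nat.
Local Notation N := (m * b).
Hypothesis ltnN : n < N.

Lemma clean_add_trit A t : A 0 = 0 -> (forall u, N < u -> A u = 0) ->
  add_trit inp M A t 0 = 0 /\ forall u, N < u -> add_trit inp M A t u = 0.
Proof.
move=> A0 big; rewrite /add_trit; case: ifPn => // /norP[t0 l0].
split=> // u ltu; rewrite /upd; case: eqP => // _; case: eqP => [e|_]; last exact: big.
move: t0 l0; rewrite -!lt0n => t0 l0.
have := @inp_le _ Es (last_unhit inp A M + t) (leq_add l0 t0); rewrite -e => leu.
by move: (leq_trans (leq_ltn_trans leu ltnN) (ltnW ltu)); rewrite ltnn.
Qed.

Definition clean (A : nat -> nat) := A 0 = 0 /\ forall u, N < u -> A u = 0.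

Lemma clean_process A dg k : clean A -> clean (process inp b T M A dg k).
Proof.
move=> cA; elim: k => //= k; move: (process _ _ _ _ _ _ _) => B.
elim: [seq _ | _ <- _] B => //= t l IH B [B0 big]; apply: IH.
exact: clean_add_trit.
Qed.

Lemma clean_outcome x A : clean A -> clean (outcome inp b W (flatten rows) M m x A).
Proof.
move=> [A0 big]; apply: clean_process; split=> // u ltu.
by rewrite [u <= N]leqNgt ltu andbF big.
Qed.

Lemma eq_process_digits A dg dg' k : (forall i, i < k -> dg i = dg' i) ->
  process inp b T M A dg k = process inp b T M A dg' k.
Proof. by elim: k => //= k IH e; rewrite IH ?e // => i lti; rewrite e // ltnW. Qed.

Section Target.
Variable S : {set 'I_n}.
Hypothesis minS : minimal_transversal (edge_set Es) S.

Definition in_target u := if insub u is Some v then v \in S else false.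

Lemma in_target_ord (v : 'I_n) : in_target v = (v \in S).
Proof. by rewrite /in_target valK. Qed.

Lemma in_target_lt u : in_target u -> u < n.
Proof. by rewrite /in_target; case: insubP. Qed.

Definition chosen i := X (fun p => in_target (i * b + p)).
Definition missing i := count (predD (fun p => in_target (i * b + p)) (chosen i)) (iota 0 b).
(** The union of the sets X over all blocks. It depends on [S] alone, so it is known before any
    branching choice is made. *)
Definition base u : nat := (0 < u <= N) && chosen (u.-1 %/ b) (u.-1 %% b).
Definition deficit A := count (fun u => in_target u && (A u.+1 == 0)) (iota 0 N).

Definition within (A : nat -> nat) := A 0 = 0 /\ forall u, A u.+1 != 0 -> in_target u.
(** [D] is the number of useful choices still to come. The first alternative covers an early finish,
    after which every further choice leaves the array alone. *)
Definition inv A D := within A /\ (last_unhit inp A M == 0 \/ deficit A <= D).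

Lemma within_base : within base.
Proof.
split=> // u; rewrite /base /= eqb0 negbK => /andP[_ /(proj1 (rowsP _))].
by rewrite -divn_eq.
Qed.

Lemma deficit_base : deficit base = \sum_(0 <= i < m) missing i.
Proof.
suff E k : k <= m -> count (fun u => in_target u && (base u.+1 == 0)) (iota 0 (k * b)) =
    \sum_(0 <= i < k) missing i by apply: E.
elim: k => [|k IH] ltk; first by rewrite mul0n big_geq.
rewrite big_nat_recr //= -IH ?(ltnW ltk) // mulSn addnC iotaD count_cat add0n; congr (_ + _).
rewrite -[k * b]addn0 iotaDl count_map; apply: eq_in_count => p; rewrite mem_iota /= => ltp.
rewrite /base /= (_ : (_ <= N) = true); last first.
  by rewrite (leq_trans _ (leq_mul ltk (leqnn b))) // mulSn addnC ltn_add2r.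
by rewrite divnMDl // modnMDl divn_small // modn_small // addn0 eqb0 andbC.
Qed.

Lemma within_support A : within A -> support n A \subset S.
Proof.
move=> [_ w]; apply/subsetP => v; rewrite inE => /w; by rewrite in_target_ord.
Qed.

(** A transversal inside [S] is [S] by minimality, so stopping early is as good as running out of
    missing vertices. *)
Lemma within_hit A : within A -> last_unhit inp A M = 0 \/ deficit A = 0 -> support n A = S.
Proof.
move=> wA [l0|d0]; have sub := within_support wA.
  apply/eqP; rewrite eqEproper sub; apply/negP => pr.
  have /andP[_ /forallP /(_ (support n A)) /implyP /(_ pr)] := minS.
  by rewrite transversal_support ?l0 //; case: wA.
apply/eqP; rewrite eqEsubset sub /=; apply/subsetP => v vS; rewrite inE;
  apply: contraT => /negPn Av.
have : 0 < deficit A; last by rewrite d0.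
rewrite -has_count; apply/hasP; exists (v : nat); last by rewrite in_target_ord vS.
by rewrite mem_iota /= add0n (ltn_trans _ ltnN).
Qed.

(** An edge missed by the current set meets [S] in some vertex, which is therefore new; the right
    choice is the slot of that vertex. If nothing is missed, any choice works. *)
Lemma inv_add_trit A D : inv A D.+1 -> exists2 t, is_trit t & inv (add_trit inp M A t) D.
Proof.
move=> [wA [l0|dA]]; first by exists 1 => //; rewrite /add_trit l0; split=> //; left.
have [[l0 _]|[k [ltk un l]]] := last_unhit_spec Es A M.
  by exists 1 => //; rewrite /add_trit l0; split=> //; left; rewrite l0.
have [A0 w] := wA.
have /andP[/forall_inP /(_ _ (in_edge_set ltk)) /existsP[v /andP[ve vS]] _] := minS.
rewrite inE in ve; have /andP[_ le3] := allP rank3 _ (mem_nth [::] ltk).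
have [j ltj sj] := slot_mem le3 ve.
have Av := (unhitP rank3 A0 ltk un) v ve.
exists j.+1; first by rewrite /is_trit.
have -> : add_trit inp M A j.+1 = upd (upd A v.+1 1) 0 0.
  rewrite /add_trit l (_ : 3 * k + 1 + j.+1 = 3 * k + (2 + j)); last by lia.
  by rewrite (inp_slot ltk ltj) sj addn1.
split.
  split=> // u; rewrite /upd /= eqSS; case: (u =P _) => [->|_]; last exact: w.
  by rewrite in_target_ord.
have ltv : v < N by rewrite (ltn_trans _ ltnN).
right; rewrite -ltnS (leq_trans _ dA) // /deficit.
set P := fun u => _ && (A u.+1 == 0); set P' := fun u => _.
(* The 1 to be gained is written as the number of occurrences of [v] in the range; the new deficit
   and this singleton are disjoint parts of the old deficit. *)
have /esym := count_uniq_mem (v : nat) (iota_uniq 0 N); rewrite mem_iota ltv /= => c1.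
rewrite -addn1 c1 -count_predUI (_ : count (predI _ _) _ = 0) ?addn0.
  apply: sub_count => u /orP[|/eqP->]; last by rewrite /P in_target_ord vS Av.
  by rewrite /P' /P /upd /= eqSS; case: (u =P _) => // _; rewrite andbF.
apply/eqP; rewrite -leqn0 leqNgt -has_count; apply/hasP => -[u _ /andP[+ /eqP eu]].
by rewrite /P' eu /upd /= eqxx andbF.
Qed.

Lemma inv_add_trits d D A : inv A (d + D) ->
  exists ts, [/\ size ts = d, all is_trit ts & inv (foldl (add_trit inp M) A ts) D].
Proof.
elim: d A => [|d IH] A; first by exists [::].
move=> /inv_add_trit[t t3 /IH[ts [szt tst I]]].
by exists (t :: ts); rewrite /= szt t3.
Qed.

(** Rows are selected block by block: the choices of block [k] depend on the set reached through the
    earlier blocks, but their number [missing k] does not. *)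
Lemma exists_row_indices k : k <= m -> exists js,
  [/\ size js = k, all (fun j => j < W) js,
      forall i p, i < k -> p < b -> T (nth 0 js i * (2 * b) + p) = chosen i p &
      inv (process inp b T M base (nth 0 js) k) (\sum_(k <= i < m) missing i)].
Proof.
elim: k => [|k IH] ltk.
  by exists [::]; split=> //; split; [exact: within_base | right; rewrite deficit_base].
have [js [szj jsW jsT I]] := IH (ltnW ltk).
rewrite big_ltn // in I; have [ts [szt tst {}I]] := inv_add_trits I.
have row_in := (proj2 (rowsP _)) _ szt tst; rewrite -/(chosen k) in row_in.
set r := row b (chosen k) ts in row_in; set j := index r rows.
have ltj : j < W by rewrite index_mem.
have leb : size ts <= b by rewrite szt (leq_trans (count_size _ _)) ?size_iota.
have Tj p : p < 2 * b -> T (j * (2 * b) + p) = nth 0 r p.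
  by move=> ltp; rewrite (nth_flatten_rows szrows) // nth_index.
have nth_js i : i < k -> nth 0 (rcons js j) i = nth 0 js i by move=> lti; rewrite nth_rcons szj lti.
have nth_k : nth 0 (rcons js j) k = j by rewrite nth_rcons szj ltnn eqxx.
exists (rcons js j); split; first by rewrite size_rcons szj.
- by rewrite all_rcons ltj.
- move=> i p; rewrite ltnS leq_eqVlt => /orP[/eqP->|lti] ltp; last by rewrite nth_js // jsT.
  rewrite nth_k Tj; last by lia.
  by rewrite /r /row nth_cat size_map size_iota ltp (nth_map 0) ?size_iota // nth_iota.
rewrite /= nth_k (eq_process_digits _ nth_js).
have -> : [seq T (j * (2 * b) + b + p) | p <- iota 0 b] = ts ++ nseq (b - size ts) 0.
  apply: (@eq_from_nth _ 0); rewrite size_map size_iota.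
    by rewrite size_cat size_nseq subnKC.
  move=> p ltp.
  rewrite (nth_map 0) ?size_iota // nth_iota // add0n -addnA Tj; last by lia.
  by rewrite /r /row nth_cat size_map size_iota ltnNge leq_addr /= addKn.
by rewrite foldl_cat; elim: (b - size ts).
Qed.

(** Quantified over all clean arrays, since the iteration starts from whatever its predecessor left
    behind. *)
Definition hits x := forall A, clean A -> let B := outcome inp b W (flatten rows) M m x A in
  support n B = S /\ forall u, n < u -> B u = 0.

Lemma exists_hit : exists2 x, x < W ^ m & hits x.
Proof.
have [js [szj jsW jsT [wB I]]] := exists_row_indices (leqnn m).
have [x ltx Hx] := exists_digits jsW; rewrite szj in ltx Hx.
exists x => // A [A0 big] B.
have eB : B =1 process inp b T M base (nth 0 js) m.
  rewrite -(eq_process_digits _ Hx) /B /outcome; apply: eq_process => u.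
  rewrite /base; case: ifP => [/andP[u0 leu]|/negbT]; last first.
    by rewrite negb_and -leqNgt leqn0 -ltnNge => /orP[/eqP->|/big].
  have lt : u.-1 %/ b < m by rewrite ltn_divLR // prednK.
  by rewrite /start Hx // jsT ?ltn_pmod.
have eS : support n B = support n (process inp b T M base (nth 0 js) m) by apply/setP => v;
  rewrite !inE eB.
split; first rewrite eS.
  apply: within_hit => //; case: I => [/eqP|]; first by left.
  by rewrite big_geq // leqn0 => /eqP; right.
move=> [//|u] ltu; rewrite eB; apply/eqP; apply: contraT => /(proj2 wB) /in_target_lt; lia.
Qed.

End Target.
End Completeness.

(** * The main loop *)

Lemma code_inj A A' k : code A k = code A' k -> forall v, 0 < v <= k -> (A v != 0) = (A' v != 0).
Proof.
rewrite /code; elim: k => [|k IH] e v; first by case: v.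
have {}e : code A k = code A' k /\ (A k.+1 != 0) = (A' k.+1 != 0).
  move: e; rewrite iotaSr !foldl_rcons -!/(code _ _) add1n.
  by case: (A _ != 0); case: (A' _ != 0) => /= e; split=> //; lia.
case: e => e1 e2; case/andP=> v0; rewrite leq_eqVlt => /orP[/eqP-> //|ltv].
by apply: IH => //; rewrite v0.
Qed.

Lemma eq_code A A' k : (forall v, 0 < v <= k -> (A v != 0) = (A' v != 0)) -> code A k = code A' k.
Proof.
elim: k => // k IH e; rewrite /code iotaSr !foldl_rcons -!/(code _ _) add1n e ?leqnn //.
by rewrite IH // => v /andP[v0 lev]; apply: e; rewrite v0 leqW.
Qed.

Section Characteristic.
Variable n : nat.
Implicit Types S : {set 'I_n}.

Definition char_fun S u : nat := (0 < u) && in_target S u.-1.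

Lemma support_char S : support n (char_fun S) = S.
Proof. by apply/setP => v; rewrite inE /char_fun /= in_target_ord eqb0 negbK. Qed.

Lemma char_support A N v : (forall u, n < u <= N -> A u = 0) -> 0 < v <= N ->
  (A v != 0) = (char_fun (support n A) v != 0).
Proof.
case: v => // v big /= lev; rewrite /char_fun /= eqb0 negbK.
have [ltv|gev] := ltnP v n; first by rewrite (in_target_ord (support n A) (Ordinal ltv)) inE.
rewrite big ?ltnS ?gev //=; apply/esym/negbTE/negP => /in_target_lt.
by rewrite ltnNge gev.
Qed.

Lemma listing_char S N : n <= N -> listing (char_fun S) N = [seq (nat_of_ord v).+1 | v <- enum S].
Proof.
move=> le; rewrite /listing -(subnKC le) iotaD filter_cat.
rewrite [X in _ ++ X](_ : _ = [::]) ?cats0; last first.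
  apply/eqP; rewrite -(negbK (_ == _)) -has_filter; apply/hasP => -[[//|u]].
  rewrite mem_iota /char_fun /= eqb0 negbK add1n ltnS => /andP[leu _] /in_target_lt.
  by rewrite ltnNge leu.
rewrite -[1]addn0 iotaDl filter_map /= -val_enum_ord filter_map -map_comp.
rewrite {1}/enum_mem -filter_predI /enum_mem; congr (map _ _); apply: eq_filter => v /=.
by rewrite /char_fun /= in_target_ord eqb0 negbK andbT.
Qed.
End Characteristic.

Section Main.
Variables (n : nat) (Es : seq (seq 'I_n)).
Hypothesis rank3 : all (fun e => uniq e && (size e <= 3)) Es.
Local Notation inp := (inp Es).
Local Notation M := (size Es).
Variables (b : nat) (rows : seq (seq nat)) (X : pred nat -> pred nat).
Hypotheses (b_gt0 : 0 < b) (szrows : all (fun r => size r == 2 * b) rows).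
Hypothesis W_gt0 : 0 < size rows.
Hypothesis rowsP : forall s, subpred (X s) s /\
  forall ts, size ts = count (predD s (X s)) (iota 0 b) ->
        all is_trit ts -> row b (X s) ts \in rows.
Local Notation W := (size rows).
Local Notation tab := (flatten rows).
Local Notation T := (nth 0 tab).
Local Notation run := (sem inp).

Definition output (L : seq {set 'I_n}) :=
  flatten [seq rcons [seq (nat_of_ord v).+1 | v <- enum Y] 0 | Y : {set 'I_n} <- L].

Section Loop.
Variable m : nat.
Local Notation N := (m * b).
Hypothesis ltnN : n < N.

(** [L] is the list of sets printed so far, in order. The marks are exactly their codes, so looking
    up a cell decides whether a candidate is new. *)
Definition found (mark : nat -> nat) (o : seq nat) k (L : seq {set 'I_n}) := [/\ uniq L,
  forall S, S \in L -> minimal_transversal (edge_set Es) S,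
  forall x S, x < k -> hits Es b rows m S x -> minimal_transversal (edge_set Es) S -> S \in L,
  forall c, (mark c != 0) = (c \in [seq code (char_fun Y) N | Y <- L]) &
  o = output L].

Lemma code_char_inj : injective (fun S : {set 'I_n} => code (char_fun S) N).
Proof.
move=> S S' /code_inj e; rewrite -(support_char S) -(support_char S').
by apply/setP => v; rewrite !inE e //= (leq_trans _ (ltnW ltnN)).
Qed.

Lemma found_step Q s k L : rg s rx = k -> k < Q -> rg s rm = m -> rg s rN = N ->
  rg s rM = M -> tables b W Q T s -> clean b m (hp s aS) -> found (hp s aMARK) (ou s) k L ->
  let s' := run (iteration b) s in
  [/\ [/\ rg s' rx = k.+1, rg s' rm = m, rg s' rN = N & rg s' rM = M],
      tables b W Q T s', clean b m (hp s' aS) &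
      exists L', found (hp s' aMARK) (ou s') k.+1 L'].
Proof.
move=> sx ltk sm sN sM tabs cA [uL mL hL kL oL] s'.
have [R' tabs' eA] := iteration_spec inp b_gt0 W_gt0 sx ltk sm sN sM tabs.
set B := outcome _ _ _ _ _ _ _ _ in eA * => res.
have cB : clean b m B by apply: clean_outcome.
split=> //; first by split=> [|u ltu]; rewrite eA; case: cB => // _ ->.
have hitB S : hits Es b rows m S k -> support n B = S /\ forall u, n < u -> B u = 0 by apply.
have B0 : B 0 = 0 by case: cB.
have step_old L' : (forall S, hits Es b rows m S k -> minimal_transversal (edge_set Es) S -> S
  \in L') ->
    {subset L <= L'} -> forall x S, x < k.+1 -> hits Es b rows m S x ->
    minimal_transversal (edge_set Es) S -> S \in L'.
  move=> H sub x S; rewrite ltnS leq_eqVlt => /orP[/eqP->|ltx] hx minS; first exact: H.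
  by apply: sub; apply: hL hx minS.
have hit_minimal S : hits Es b rows m S k -> minimal_transversal (edge_set Es) S ->
    minimal_hit inp B M N.
  move=> /hitB[eS big] minS; apply/(minimal_hitP rank3 B0 (ltnW ltnN)).
  by rewrite eS; split=> // u /andP[ltu _]; apply: big.
have codeB : minimal_hit inp B M N -> code B N = code (char_fun (support n B)) N.
  move=> /(minimal_hitP rank3 B0 (ltnW ltnN))[_ big].
  by apply: eq_code => v; apply: char_support.
move: res; case: ifP => [/andP[mh /eqP mk]|nomh] [eM eO].
  have [minB big] := minimal_hitP rank3 B0 (ltnW ltnN) mh.
  have nB : support n B \notin L.
    rewrite -(mem_map code_char_inj) -kL -codeB //; exact/negPn/eqP.
  exists (rcons L (support n B)); split.
  - by rewrite rcons_uniq nB.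
  - by move=> S; rewrite mem_rcons inE => /orP[/eqP-> //|/mL].
  - apply: step_old => [S hS minS|S SL]; last by rewrite mem_rcons inE SL orbT.
    by rewrite mem_rcons inE; case: (hitB S hS) => ->; rewrite eqxx.
  - move=> c; rewrite eM map_rcons mem_rcons inE -codeB // -kL /upd.
    by case: (c =P _).
  rewrite eO oL /output map_rcons flatten_rcons; congr (_ ++ rcons _ _).
  rewrite -(@listing_char n _ N (ltnW ltnN)); apply: eq_in_filter => v.
  by rewrite mem_iota => /andP[v0 lev]; apply: char_support big _; rewrite v0 -ltnS.
exists L; split=> //; try by rewrite ?eM ?eO.
apply: step_old => // S hS minS; have mh := hit_minimal S hS minS.
move: nomh; rewrite mh /= => /negbT; rewrite kL codeB //.
have [<- _] := hitB S hS; by rewrite (mem_map code_char_inj).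
Qed.
End Loop.

Lemma main_spec R : R rn = n -> R rM = M ->
  exists L, [/\ uniq L, forall S, (S \in L) = minimal_transversal (edge_set Es) S &
    ou (run (main b W tab) (LS R (fun _ _ => 0) [::])) = output L].
Proof.
move=> Rn RM; set s0 := LS _ _ _; rewrite /main 4!sem_seq.
set s1 := run (tabinit _) s0; set s2 := run (dims _ _) s1; set s3 := run (divtab _ _) s2.
set s4 := run (Asg _ _) s3.
have regs1 r : rg s1 r = R r by rewrite /s1 frame_rg // tabinit_regs.
have arr1 a : a != aT -> hp s1 a = fun=> 0 by move=> na; rewrite /s1 frame_hp // tabinit_arrays.
have n1 : rg s1 rn = n by rewrite regs1.
have [N2 Q2 /andP[ltnN _]] := dims_spec inp W b_gt0 n1; rewrite -/s2 in N2 Q2 ltnN.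
set m := rg s2 rm in N2 Q2.
have t4 : tables b W (W ^ m) T s4.
  have arr a : a != aDIV -> a != aMOD -> hp s4 a = hp s1 a.
    by move=> n1' n2'; rewrite /s4 frame_hp // /s3 frame_hp ?inE ?negb_or ?n1' ?n2' // /s2 frame_hp.
  have D := @divtab_spec inp b W b_gt0 W_gt0 s2; lazy zeta in D; rewrite -/s3 Q2 in D.
  by split=> [i|y /D[]|y /D[]] //; rewrite arr // /s1 tabinit_spec.
have arr4 a : a \notin [:: aT; aDIV; aMOD] -> hp s4 a = fun=> 0.
  rewrite !inE !negb_or => /and3P[na nb nc].
  by rewrite /s4 frame_hp // /s3 frame_hp ?inE ?negb_or ?nb ?nc // /s2 frame_hp // arr1.
have o4 : ou s4 = [::] by rewrite /s4 frame_ou // /s3 frame_ou // /s2 frame_ou // /s1 frame_ou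
  // tabinit_silent.
have m4 : rg s4 rm = m by rewrite /s4 frame_rg // /s3 frame_rg.
have N4 : rg s4 rN = m * b by rewrite /s4 frame_rg // /s3 frame_rg.
have Q4 : rg s4 rQ = W ^ m by rewrite /s4 frame_rg // /s3 frame_rg.
have M4 : rg s4 rM = M by rewrite /s4 frame_rg // /s3 frame_rg // /s2 frame_rg // regs1.
have x4 : rg s4 rx = 0 by [].
rewrite sem_loop (_ : eval _ _ _ = W ^ m) //.
rewrite N2 in ltnN.
pose Inv k s := [/\ [/\ rg s rx = k, rg s rm = m, rg s rN = m * b & rg s rM = M],
      tables b W (W ^ m) T s, clean b m (hp s aS) &
      exists L, found m (hp s aMARK) (ou s) k L].
have [_ _ _ [L [uL mL hL _ oL]]] : Inv (W ^ m) (iter (W ^ m) (run (iteration b)) s4).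
  apply: iter_inv => [|k s ltk [[sx sm sN sM] tabs cA [L fL]]].
    split=> //; first by rewrite arr4.
    by exists [::]; rewrite arr4 // o4; split.
  exact: found_step fL.
exists L; split=> // S; apply/idP/idP => [/mL //|minS].
have [x ltx hx] := exists_hit rank3 b_gt0 szrows rowsP ltnN minS.
exact: hL hx minS.
Qed.
End Main.

(** * Running time *)

(** Each edge is determined by three slots with values in 0, ..., n, and the edges are distinct as
    sets. This makes every scan of the edges polynomial in [n]. *)
Lemma size_edges_le n (Es : seq (seq 'I_n)) :
  all (fun e => uniq e && (size e <= 3)) Es ->
  uniq [seq [set x in e] | e <- Es] -> size Es <= n.+1 ^ 3.
Proof.
move=> rank3 uEs.
pose slots (e : seq 'I_n) : 'I_n.+1 * 'I_n.+1 * 'I_n.+1 :=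
  (inord (slot e 0), inord (slot e 1), inord (slot e 2)).
pose decode (t : 'I_n.+1 * 'I_n.+1 * 'I_n.+1) : {set 'I_n} :=
  [set v : 'I_n | [|| v.+1 == t.1.1 :> nat, v.+1 == t.1.2 :> nat | v.+1 == t.2 :> nat]].
have slot_le (e : seq 'I_n) j : slot e j < n.+1.
  by case E : (slot e j) => [//|u]; have [v _ ->] := slot_eq E; rewrite ltnS.
have decodeK e : e \in Es -> decode (slots e) = [set x in e].
  move=> /(allP rank3)/andP[_ le3]; apply/setP => v; rewrite !inE /= !inordK //.
  apply/or3P/idP => [|/(slot_mem le3)[[|[|[|j]]] // _ <-]].
  - by case=> /eqP/esym/slot_eq[w we /val_inj ->].
  - exact: Or31.
  - exact: Or32.
  - exact: Or33.
have : uniq [seq decode t | t <- [seq slots e | e <- Es]].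
  rewrite -map_comp (_ : [seq _ | _ <- Es] = [seq [set x in e] | e <- Es]) //.
  by apply/eq_in_map => e /decodeK.
move/map_uniq/card_uniqP; rewrite size_map => <-.
by rewrite (leq_trans (max_card _)) // !card_prod !card_ord !expnS expn0 muln1 mulnA.
Qed.

Section Cost.
Variables (inp : nat -> nat) (b : nat) (rows : seq (seq nat)).
Hypotheses (b_gt0 : 0 < b) (W_gt0 : 0 < size rows).
Local Notation W := (size rows).
Local Notation tab := (flatten rows).

Lemma wf_main : wfc 100 (main b W tab) 0.
Proof.
have -> : wfc 100 (main b W tab) 0 = wfc 100 (tabinit tab) 0 by rewrite /= andbT.
by rewrite /tabinit; elim: (iota _ _).
Qed.

Lemma cost_tabinit s : cost inp (tabinit tab) s = weight (tabinit tab).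
Proof. by rewrite /tabinit; elim: (iota _ _) s => //= i l IH s; rewrite IH. Qed.

Lemma cost_seq c1 c2 s : cost inp (Seq c1 c2) s = cost inp c1 s + cost inp c2 (sem inp c1 s).
Proof. by []. Qed.

Lemma cost_asg r e s : cost inp (Asg r e) s = ecost e + 2.
Proof. by []. Qed.

Definition bound_regs : pred nat := fun r => r < 5.

Lemma loops_iteration B s : rg s rm <= B -> rg s rN <= B -> rg s rM <= B -> b <= B ->
  loops_le inp B s (iteration b).
Proof. by move=> lm lN lM lb; rewrite /= lm lN lM lb. Qed.

(** The exponent 3 is the loop depth of one iteration, reached by searching all edges for each
    choice of each block. The setup phases fit into the same bound, so the weights simply add up. *)
Lemma cost_main R : let n := R rn in let M := R rM in
  exists m, n < m * b <= n + b /\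
  forall B, 0 < B -> n < B -> M <= B -> m <= B -> m * b <= B -> b <= B -> W <= B ->
    cost inp (main b W tab) (LS R (fun _ _ => 0) [::]) <=
    weight (main b W tab) * B ^ 3 * W ^ m.
Proof.
move=> n M; set s0 := LS _ _ _.
set s1 := sem inp (tabinit tab) s0; set s2 := sem inp (dims b W) s1;
  set s3 := sem inp (divtab b W) s2.
set s4 := sem inp (Asg rx (Const 0)) s3.
have regs1 r : rg s1 r = R r by rewrite /s1 frame_rg // tabinit_regs.
have [N2 Q2 range] := @dims_spec inp b W b_gt0 s1 n (regs1 rn); rewrite -/s2 in N2 Q2 range.
exists (rg s2 rm); rewrite -N2; split=> // B B0 ltnB leM lem leN leb leW.
set Q := W ^ _; set Z := B ^ 3 * Q; rewrite -mulnA -/Z.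
have Q_gt0 : 0 < Q by rewrite expn_gt0 W_gt0.
have B3_gt0 : 0 < B ^ 3 by rewrite expn_gt0 B0.
have leBZ : B ^ 3 <= Z by rewrite leq_pmulr.
have leQZ : Q <= Z by rewrite leq_pmull.
have ct : cost inp (tabinit tab) s0 <= weight (tabinit tab) * Z.
  by rewrite cost_tabinit leq_pmulr // (leq_trans Q_gt0).
have cd : cost inp (dims b W) s1 <= weight (dims b W) * Z.
  rewrite (leq_trans (@cost_static inp (pred1 rn) B (dims b W) s1 B0 isT _)) //.
    by rewrite /= regs1 addn1 ltnB leW.
  by rewrite leq_mul2l (leq_trans _ leBZ) ?orbT // leq_pexp2l.
have cv : cost inp (divtab b W) s2 <= weight (divtab b W) * Z.
  rewrite /divtab 3!cost_seq; set sl := sem inp _ (sem inp _ (sem inp _ s2)).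
  have := @cost_loop_static inp (pred1 rQ) B (Reg rQ) (divtab_body b W) sl B0 isT isT.
  rewrite (_ : eval inp sl (Reg rQ) = Q); last exact: Q2.
  rewrite expn0 muln1; move: (cost _ _ sl) => x lex.
  have Qw : Q * (weight (divtab_body b W) + 5) <= (weight (divtab_body b W) + 5) * Z.
    by rewrite mulnC leq_mul2l leQZ orbT.
  have Z_gt0 := leq_trans Q_gt0 leQZ.
  rewrite !cost_asg [ecost (Const 0)]/= [ecost (Reg rQ)]/= in lex *.
  rewrite (_ : weight _ = 9 + (3 + (weight (divtab_body b W) + 5))) //.
  move: (weight (divtab_body b W)) Qw lex => wd Qw lex; clearbody Z Q; clear - Qw lex Z_gt0; lia.
have ci : cost inp (Loop (Reg rQ) (iteration b)) s4 <= (3 + (weight (iteration b) + 5)) * Z.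
  have r4 r : r \notin [:: rx; rq; rr] -> rg s4 r = rg s2 r.
    by rewrite !inE !negb_or => /and3P[n1 n2 n3];
      rewrite /s4 frame_rg ?inE // /s3 frame_rg // !inE !negb_or n1 n2 n3.
  have lm : rg s4 rm <= B by rewrite r4.
  have lN : rg s4 rN <= B by rewrite r4.
  have lM : rg s4 rM <= B by rewrite r4 // /s2 frame_rg // regs1.
  have loops := loops_iteration lm lN lM leb.
  have := @cost_loop_static inp bound_regs B (Reg rQ) (iteration b) s4 B0 isT loops.
  rewrite (_ : eval inp s4 (Reg rQ) = Q); last by rewrite /Q -Q2; exact: r4.
  rewrite (_ : depth (iteration b) = 3) // [ecost _]/=.
  move/leq_trans; apply; move: (weight (iteration b)) leQZ (leq_trans Q_gt0 leQZ) => wi lQ Z0.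
  have -> : Q * (wi * B ^ 3 + 5) =
    wi * Z + 5 * Q by rewrite mulnDr mulnCA [Q * _]mulnC -/Z [Q * 5]mulnC.
  clearbody Z Q; clear - lQ Z0; lia.
have -> : cost inp (main b W tab) s0 = cost inp (tabinit tab) s0 + (cost inp (dims b W) s1 +
    (cost inp (divtab b W) s2 + (3 + cost inp (Loop (Reg rQ) (iteration b)) s4))) by [].
rewrite (_ : weight _ = weight (tabinit tab) + (weight (dims b W) + (weight (divtab b W) + (3
  + (3 + (weight (iteration b) + 5)))))) //.
rewrite mulnDl (leq_add ct) // mulnDl (leq_add cd) // mulnDl (leq_add cv) //.
move: (leq_trans Q_gt0 leQZ) ci; move: (cost _ _ _) (weight _) => x w.
clearbody Z; clear; lia.
Qed.
End Cost.

(** The bound on [W] per block gives 1.67 per vertex, padding included. The padding has at most [b]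
    vertices, so it costs only the constant 167^b. *)
Lemma blocks_rate b W m n : W * 100 ^ b <= 167 ^ b -> n < m * b <= n + b ->
  W ^ m * 100 ^ n <= 167 ^ b * 167 ^ n.
Proof.
move=> rate /andP[/ltnW lt le].
have := leq_expl m rate; rewrite expnMn -!expnM [b * m]mulnC -(subnKC lt) !expnD mulnA.
have ler : m * b - n <= b by lia.
move: (m * b - n) ler => r ler le_pow.
rewrite (leq_trans (leq_pmulr _ (_ : 0 < 100 ^ r))) ?expn_gt0 // (leq_trans le_pow) //.
by rewrite [X in _ <= X]mulnC leq_mul2l leq_pexp2l ?orbT.
Qed.

(** Variables [x] and [y] stand for the two constants of the final bound, so that the argument never
    handles large unary numerals. One factor 100^n of x^n turns W^m into 167^n; the other makes up
    the base 167 * 100, strictly below [y]. *)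
Lemma enumeration_program (x y : nat) : x <= 100 * 100 -> 167 * 100 < y ->
  exists (P : seq instr) (c : nat),
    forall (n : nat) (Es : seq (seq 'I_n)),
      all (fun e => uniq e && (size e <= 3)) Es ->
      uniq [seq [set x in e] | e <- Es] ->
      exists (t : nat) (fin : state),
        [/\ exec P t (init_state Es) = Some fin,
            t * x ^ n <= c * y ^ n
          & enumerates (min_transversals (edge_set Es)) (out fin)].
Proof.
move=> le_x lt_y; have lt_xy : x < y by lia.
have [b [rows [X [b_gt0 W_gt0 rate szrows rowsP]]]] := exists_table.
set W := size rows in W_gt0 rate; pose prog := main b W (flatten rows).
(* The exponent 9 is 3 * 3: a cost cubic in a loop bound that is itself cubic in [n.+1], because of
   the number of edges. *)
have [c0 Hc0] := @poly_expn_le (167 * 100) y 9 lt_y.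
have {lt_y} le_xy k : x ^ k <= y ^ k by apply/leq_expl/ltnW.
have {le_x} le_x k : x ^ k <= 100 ^ k * 100 ^ k by rewrite -expnMn leq_expl.
pose w := size (prelude 100) + weight prog + 2;
  have wE : w = size (prelude 100) + weight prog + 2 by []; clearbody w.
exists (program 100 prog), (4 + w * (b + W + 1) ^ 3 * 167 ^ b * c0).
move=> n Es rank3 uEs.
have [Es0|Es_gt0] := posnP (size Es).
  case: Es rank3 uEs Es0 => // _ _ _.
  have [fin [ex outE]] := program_no_edges 100 prog n.
  exists 4, fin; split=> //; first by apply: leq_mul; rewrite ?leq_addr.
  rewrite outE; exists [:: [::]]; split=> // S.
  rewrite inE minimal_transversalE /= mem_seq1 set_nil.
  have trT (S' : {set 'I_n}) : Defs.transversal (edge_set ([::] : seq (seq 'I_n))) S'.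
    by apply/forall_inP => e; rewrite inE.
  rewrite trT /=; apply/forall_inP/eqP => [H|-> v]; last by rewrite inE.
  by apply/setP => v; rewrite inE; apply/negP => /H; rewrite trT.
have [R [t [fin [Rn RM ex let_ outE]]]] := @program_correct 100 prog n Es isT (wf_main b rows)
  Es_gt0.
exists t, fin; split=> //; last first.
  have [L [uL mL oL]] := main_spec rank3 b_gt0 szrows W_gt0 rowsP Rn RM.
  exists [seq enum Y | Y : {set 'I_n} <- L].
  have E : [seq [set x in s] | s <- [seq enum Y | Y : {set 'I_n} <- L]] = L.
    by rewrite -map_comp map_id_in // => S _ /=; rewrite set_enum.
  split; rewrite ?E //.
  - by apply/allP => _ /mapP[S _ ->]; apply: enum_uniq.
  - by move=> S; rewrite inE mL.
  - by rewrite outE oL /output -map_comp.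
have [m [range /(_ ((b + W + 1) * n.+1 ^ 3)) Hcost]] := cost_main (inp Es) b_gt0 W_gt0 R.
rewrite Rn RM in range Hcost.
have {Hcost} costB : cost (inp Es) prog (LS R (fun _ _ => 0) [::]) <=
    weight prog * ((b + W + 1) * n.+1 ^ 3) ^ 3 * W ^ m.
  have n3 : n < n.+1 ^ 3 by have := @leq_pexp2l n.+1 1 3 isT isT; rewrite expn1.
  have leM := size_edges_le rank3 uEs; move: (n.+1 ^ 3) n3 leM Hcost => f n3 leM.
  have f0 : 0 < f by apply: leq_trans n3.
  have bf := leq_pmulr b f0; have Wf := leq_pmulr W f0; have mb := leq_pmulr m b_gt0.
  have BE : (b + W + 1) * f = b * f + W * f + f by rewrite !mulnDl mul1n.
  have {}range : m * b <= n + b by case/andP: range.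
  by apply; rewrite BE; lia.
have tw : t <= w * ((b + W + 1) * n.+1 ^ 3) ^ 3 * W ^ m.
  move: let_ costB; rewrite {}wE; move: (size (prelude 100)) (weight prog) => p q.
  set f := _ ^ 3; move: (cost _ _ _) => k lt_ le_k.
  have : 0 < f * W ^ m by rewrite !(muln_gt0, expn_gt0) W_gt0 addn1.
  clearbody f; rewrite -[_ * f * _]mulnA in le_k; rewrite -[_ * f * _]mulnA.
  move: (f * _) le_k => z le_k z_gt0.
  by rewrite (leq_trans lt_) // !mulnDl !leq_add ?leq_pmulr.
have rW := blocks_rate rate range.
have {Hc0} Hn := Hc0 n; rewrite expnMn in Hn; have {le_x} le_x := le_x n.
rewrite expnMn -expnM in tw; rewrite mulnDl (leq_trans _ (leq_addl _ _)) //.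
move: (x ^ n) (y ^ n) (n.+1 ^ (3 * 3)) (167 ^ n) (100 ^ n) (167 ^ b) (W ^ m) ((b + W + 1) ^ 3)
  Hn rW le_x tw.
move=> x' y' p u v z Z g Hn rW le_x tw.
rewrite (leq_trans (leq_mul tw le_x)) //.
have -> : w * (g * p) * Z * (v * v) = w * g * p * v * (Z * v) by lia.
rewrite (leq_trans (leq_mul (leqnn _) rW)) //.
have -> : w * g * p * v * (z * u) = w * g * z * (p * (u * v)) by lia.
by rewrite -[_ * c0 * _]mulnA leq_mul2l Hn orbT.
Qed.

Theorem theorem1 :
  exists (P : seq instr) (c : nat),
    forall (n : nat) (Es : seq (seq 'I_n)),
      all (fun e => uniq e && (size e <= 3)) Es ->
      uniq [seq [set x in e] | e <- Es] ->
      exists (t : nat) (fin : state),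
        [/\ exec P t (init_state Es) = Some fin,
            t * 10000 ^ n <= c * 16755 ^ n
          & enumerates (min_transversals (edge_set Es)) (out fin)].
Proof. by apply: enumeration_program; vm_compute. Qed.
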